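(* Let $a\in\Delta$ with $a_i>0$ for all $1\le i\le d$, let $k=Na$, where $N\to\infty$ through positive integers for which $Na\in\mathbb{Z}^d$, and let $\gamma=\log\left(\pi^d\prod_{i=1}^d(2\pi a_i)^{1/2}\right)$. Then the following rescaled distribution laws hold as $N\to\infty$ (with $\sim$ meaning that the ratio of the two sides tends to $1$), in each case in the form $$\sigma_{N,k}([t_N,\infty))\;\sim\;(2\pi)^d\,\gamma_d\prod_{i=1}^d\left(\frac{a_i\,\varepsilon_N}{2}\right)^{1/2}:$$ (i) for fixed $t>0$ with $\log t<-\gamma$, with $t_N=N^{d/2}t$ and $\varepsilon_N=\frac{-\log t-\gamma}{N}$; (ii) for fixed $t>0$ and real $\alpha,\beta$ with either $0<\alpha<1$, or $\alpha=0$ and $\beta>1$, with $t_N=e^{-N^\alpha(\log N)^\beta t}$ and $\varepsilon_N=N^{\alpha-1}(\log N)^\beta t$; (iii) for fixed real $t$ with $d+2t>0$, with $t_N=N^{-t}$ and $\varepsilon_N=\frac{d+2t}{2N}\log N$.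
   Context: Let $G$ be a subtorus of $T^d=(S^1)^d$ with Lie algebra $\mathfrak g\subset\mathbb{R}^d$, let $L:(\mathbb{R}^d)^*\to\mathfrak g^*$ be the dual of the inclusion, $e_1^*,\dots,e_d^*$ the standard dual basis, $\alpha_i=Le_i^*$, and let $\lambda\in\mathbb{Z}_G^*$ be a weight of $G$ such that the reduction of $\mathbb{C}^d$ by $G$ at $\lambda$ is a compact toric (Kähler) manifold; $\Delta=\{x\in\mathbb{R}^d:\ x_i\ge0,\ \sum_ix_i\alpha_i=\lambda\}$. For $k\in\mathbb{Z}_{\ge0}^d$ and a positive integer $N$, let $z^k=z_1^{k_1}\cdots z_d^{k_d}$, let $dz\,d\bar z$ denote Lebesgue measure on $\mathbb{C}^d$, let $c_{N,k}^2=\int_{\mathbb{C}^d}|z^k|^2e^{-N|z|^2}dz\,d\bar z=\left(\frac\pi N\right)^d\prod_i\frac{k_i!}{N^{k_i}}$, and for $s>0$ let $$\langle s_k,s_k\rangle(z)=\frac1{c_{N,k}^2}|z^k|^2e^{-N|z|^2},\qquad \sigma_{N,k}([s,\infty))=\operatorname{Vol}\{z\in\mathbb{C}^d:\ \langle s_k,s_k\rangle(z)\ge s\},$$ where $\operatorname{Vol}$ is Lebesgue measure. $\gamma_d$ is the volume of the unit ball in $\mathbb{R}^d$ (distinct from the constant $\gamma$). *)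

(* Defs.v *)
From HB Require Import structures.
From mathcomp Require Import all_boot all_order all_algebra.
From mathcomp Require Import complex.
From mathcomp Require Import all_classical all_reals all_analysis.

Set Implicit Arguments.
Unset Strict Implicit.
Unset Printing Implicit Defensive.

Import Order.TTheory GRing.Theory Num.Theory.
Import numFieldNormedType.Exports.

Local Open Scope classical_set_scope.
Local Open Scope ring_scope.
Local Open Scope complex_scope.
Local Open Scope quotient_scope.

(* Canonical inference does not find this for m1 \x m2: the instance for products
   of subprobabilities comes first. *)
Lemma product_measure_sigma_finite d1 d2 (T1 : measurableType d1)
    (T2 : measurableType d2) (R : realType)
    (m1 : {sigma_finite_measure set T1 -> \bar R})
    (m2 : {sigma_finite_measure set T2 -> \bar R}) :
  sigma_finite setT (m1 \x m2)%E.
Proof.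
have /sigma_finiteP[F [TF ndF Foo]] := sigma_finiteT m1.
have /sigma_finiteP[G [TG ndG Goo]] := sigma_finiteT m2.
exists (fun n => F n `*` G n).
  rewrite -setXTT TF TG predeqE => -[x y]; split.
    move=> [/= [n _ Fnx] [k _ Gky]]; exists (maxn n k) => //; split.
    - by move: x Fnx; exact/subsetPset/ndF/leq_maxl.
    - by move: y Gky; exact/subsetPset/ndG/leq_maxr.
  by move=> [n _ []/= ? ?]; split; exists n.
move=> k; have [mF Fk] := Foo k; have [mG Gk] := Goo k.
split; first exact: measurableX.
by rewrite product_measure1E// lte_mul_pinfty// ge0_fin_numE.
Qed.

Section ConsMeasure.
Local Open Scope ereal_scope.
Context {disp : measure_display} {T : measurableType disp} {R : realType}.
Variables (mu : {sigma_finite_measure set T -> \bar R}) (n : nat).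
Variable nu : {sigma_finite_measure set (n.-tuple T) -> \bar R}.

Definition tcons (p : T * n.-tuple T) : n.+1.-tuple T := [tuple of p.1 :: p.2].

Lemma measurable_tcons : measurable_fun [set: T * n.-tuple T] tcons.
Proof. exact: (measurable_cons measurable_fst measurable_snd). Qed.

Definition cons_measure : set (n.+1.-tuple T) -> \bar R :=
  pushforward (mu \x nu) tcons.

Let cons_measure0 : cons_measure set0 = 0.
Proof. by rewrite /cons_measure /pushforward preimage_set0 measure0. Qed.

Let cons_measure_ge0 A : 0 <= cons_measure A.
Proof. by apply: integral_ge0 => *; exact: measure_ge0. Qed.

Let cons_measure_sigma_additive : semi_sigma_additive cons_measure.
Proof.
move=> F mF tF mUF; rewrite /cons_measure /pushforward preimage_bigcup.
apply: measure_semi_sigma_additive.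
- by move=> i; rewrite -[X in measurable X]setTI; exact: measurable_tcons.
- apply/trivIsetP => /= i j _ _ ij; rewrite -preimage_setI.
  by move/trivIsetP : tF => /(_ _ _ _ _ ij) ->//; rewrite preimage_set0.
- by rewrite -preimage_bigcup -[X in measurable X]setTI; exact: measurable_tcons.
Qed.

HB.instance Definition _ := isMeasure.Build _ _ _ cons_measure
  cons_measure0 cons_measure_ge0 cons_measure_sigma_additive.

Let cons_measure_sigma_finite : sigma_finite setT cons_measure.
Proof.
have [F TF Foo] := product_measure_sigma_finite mu nu.
pose g (t : n.+1.-tuple T) := (thead t, [tuple of behead t]).
have gK : cancel tcons g.
  by case=> x t; rewrite /g /tcons theadE; congr pair; apply: val_inj.
have mg : measurable_fun [set: n.+1.-tuple T] g.
  by apply/measurable_fun_pairP; split;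
    [exact: measurable_tnth|exact: measurable_behead].
exists (fun i => g @^-1` F i).
  by rewrite -preimage_bigcup -TF preimage_setT.
move=> i; have [mF Fioo] := Foo i; split.
  by rewrite -[X in measurable X]setTI; exact: mg.
rewrite /cons_measure /pushforward -comp_preimage.
by rewrite (_ : g \o tcons = id) ?preimage_id//; apply/funext => p; exact: gK.
Qed.

HB.instance Definition _ := Measure_isSigmaFinite.Build _ _ _ cons_measure
  cons_measure_sigma_finite.

End ConsMeasure.

(* The n-fold product measure mu \x (mu \x ( ... )) on n.-tuple T. *)
Fixpoint power_measure {disp : measure_display} {T : measurableType disp}
    {R : realType} (mu : {sigma_finite_measure set T -> \bar R}) (n : nat) :
    {sigma_finite_measure set (n.-tuple T) -> \bar R} :=
  match n with
  | 0%N => dirac ([tuple] : 0.-tuple T)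
  | m.+1 => cons_measure mu (power_measure mu m)
  end.

Section Volume.
Context {R : realType}.
Local Notation mR := (measurableTypeR R).

Definition lebesgue2 : set (mR * mR) -> \bar R :=
  (@lebesgue_measure R \x @lebesgue_measure R)%E.

HB.instance Definition _ := Measure.on lebesgue2.
HB.instance Definition _ := Measure_isSigmaFinite.Build _ _ _ lebesgue2
  (product_measure_sigma_finite (@lebesgue_measure R) (@lebesgue_measure R)).

Definition unit_ball_volume (d : nat) : R :=
  fine (power_measure (@lebesgue_measure R) d
    [set x : d.-tuple mR | \sum_(j < d) tnth x j ^+ 2 <= 1]).

End Volume.

(* R[i]^o rather than R[i], so that C^d carries the product topology of
   'rV_d, C having the topology of its norm. *)
Notation Cvec R d := 'rV[R[i]^o]_d.

Section ComplexSpace.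
Context {R : realType} {d : nat}.
Local Notation mR := (measurableTypeR R).
Implicit Types (z : Cvec R d) (k : 'I_d -> nat).

(* The identification of (R^2)^d with C^d. The library has no measurable
   structure on C, so that Lebesgue measure on C^d is read off in these real
   coordinates. *)
Definition complex_point (x : d.-tuple (mR * mR)) : Cvec R d :=
  \row_j ((tnth x j).1 +i* (tnth x j).2).

Definition lebesgueC : set (d.-tuple (mR * mR)) -> \bar R :=
  power_measure lebesgue2 d.

Definition volC (A : set (Cvec R d)) : \bar R :=
  lebesgueC (complex_point @^-1` A).

Definition integralC (f : Cvec R d -> R) : R :=
  (\int[lebesgueC]_x f (complex_point x))%R.

Definition cnorm2 z : R := \sum_j Normc.normc (z 0 j) ^+ 2.

Definition monomial k z : R[i] := \prod_j z 0 j ^+ k j.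

(* |z^k|^2 e^{- N |z|^2} *)
Definition monomial_density (N : nat) k z : R :=
  Normc.normc (monomial k z) ^+ 2 * expR (- (N%:R * cnorm2 z)).

Definition cNk2 (N : nat) k : R := integralC (monomial_density N k).

Definition sk_norm2 (N : nat) k z : R := (cNk2 N k)^-1 * monomial_density N k z.

Definition sigmaNk (N : nat) k (A : set R) : \bar R :=
  volC (sk_norm2 N k @^-1` A).

End ComplexSpace.

Section Torus.
Context {R : realType} {d : nat}.
Implicit Types (u z : Cvec R d) (xi : 'rV[R]_d).

Definition torus : set (Cvec R d) := [set u | forall j, `|u 0 j| = 1].

(* Coordinatewise product: the group law of T^d and its action on C^d. *)
Definition tmul u z : Cvec R d := \row_j (u 0 j * z 0 j).
Definition tone : Cvec R d := const_mx 1.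
Definition tinv u : Cvec R d := \row_j (u 0 j)^-1.

(* xi |-> (e^{i xi_1}, ..., e^{i xi_d}) *)
Definition texp xi : Cvec R d := \row_j (cos (xi 0 j) +i* sin (xi 0 j)).

End Torus.

(* A subtorus of T^d is a closed connected subgroup. *)
Record subtorus (R : realType) (d : nat) := Subtorus {
  subtorus_set :> Cvec R d -> Prop;
  subtorus_sub : subtorus_set `<=` torus;
  subtorus1 : subtorus_set tone;
  subtorusM : forall u v, subtorus_set u -> subtorus_set v ->
    subtorus_set (tmul u v);
  subtorusV : forall u, subtorus_set u -> subtorus_set (tinv u);
  subtorus_closed : closed subtorus_set;
  subtorus_connected : connected subtorus_set }.

Section Orbits.
Context {R : realType} {d : nat} (G : subtorus R d) (M : set (Cvec R d)).

Definition orbit_rel : rel M :=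
  fun x y => `[< exists2 u, G u & tmul u (set_val x) = set_val y >].

Let orbit_refl : reflexive orbit_rel.
Proof.
move=> x; apply/asboolP; exists tone; first exact: subtorus1.
by apply/rowP => j; rewrite !mxE mul1r.
Qed.

Let orbit_sym : symmetric orbit_rel.
Proof.
suff H x y : orbit_rel x y -> orbit_rel y x by move=> x y; apply/idP/idP; exact: H.
move=> /asboolP[u Gu uxy]; apply/asboolP; exists (tinv u); first exact: subtorusV.
transitivity (tmul (tinv u) (tmul u (set_val x))); first by rewrite uxy.
apply/rowP => j; rewrite !mxE mulrA mulVf ?mul1r//.
by rewrite -normr_gt0 (subtorus_sub Gu) ltr01.
Qed.

Let orbit_trans : transitive orbit_rel.
Proof.
move=> y x z /asboolP[u Gu uxy] /asboolP[v Gv vyz]; apply/asboolP.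
exists (tmul v u); first exact: subtorusM.
transitivity (tmul v (tmul u (set_val x))); last by rewrite uxy.
by apply/rowP => j; rewrite !mxE mulrA.
Qed.

Definition orbit_equiv : equiv_rel M :=
  EquivRel orbit_rel orbit_refl orbit_sym orbit_trans.

Definition orbit_space : topologicalType :=
  quotient_topology {eq_quot orbit_equiv}.

End Orbits.

Section Reduction.
Context {R : realType} {d : nat}.
Variables (G : subtorus R d) (g : {vspace 'rV[R]_d}).

Definition is_lie_algebra : Prop :=
  forall xi : 'rV[R]_d, xi \in g <-> forall t : R, G (texp (t *: xi)).

(* The dual of g. *)
Local Notation dual := 'Hom(subvs_of g, R^o).

Definition std_dual (j : 'I_d) : 'Hom('rV[R]_d, R^o) :=
  linfun (fun x : 'rV[R]_d => x 0 j : R^o).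

Definition dual_incl (f : 'Hom('rV[R]_d, R^o)) : dual :=
  (f \o linfun (@vsval _ _ g))%VF.

Definition alpha (j : 'I_d) : dual := dual_incl (std_dual j).

(* Elements of the weight lattice: the differentials of the characters of G,
   i.e. lambda takes values in 2 pi Z on the kernel of exp : g -> G. *)
Definition is_weight (lambda : dual) : Prop :=
  forall xi : subvs_of g, texp (vsval xi) = tone ->
    exists m : int, lambda xi = 2 * pi * m%:~R.

Definition Delta (lambda : dual) : set 'rV[R]_d :=
  [set x | (forall j, 0 <= x 0 j) /\ \sum_j x 0 j *: alpha j = lambda].

(* The moment map of the G-action on C^d, normalized so that the level set at
   lambda is the preimage of Delta lambda under z |-> (|z_1|^2, ..., |z_d|^2). *)
Definition moment_map (z : Cvec R d) : dual :=
  \sum_j Normc.normc (z 0 j) ^+ 2 *: alpha j.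

Definition level_set (lambda : dual) : set (Cvec R d) :=
  [set z | moment_map z = lambda].

Definition reduced_space (lambda : dual) : topologicalType :=
  orbit_space G (level_set lambda).

(* The reduction at lambda is a compact toric manifold. Freeness is what makes
   the quotient a manifold: since the generating vector fields of a free action
   do not vanish, it also makes lambda a regular value of the moment map. *)
Definition compact_toric_reduction (lambda : dual) : Prop :=
  (forall u z, G u -> level_set lambda z -> tmul u z = z -> u = tone) /\
  compact [set: reduced_space lambda].

End Reduction.

Section Laws.
Context {R : realType} {d : nat} (a : 'rV[R]_d).

Definition gamma : R := ln (pi ^+ d * \prod_j Num.sqrt (2 * pi * a 0 j)).

(* The positive integers N such that N a is integral. *)
Definition admissible : set nat :=
  [set N | (0 < N)%N /\ forall j, N%:R * a 0 j \is a Num.int].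

(* N a as a multi-index, for N admissible and a nonnegative. *)
Definition multi_index (N : nat) (j : 'I_d) : nat := Num.truncn (N%:R * a 0 j).

(* sigma_{N,Na}([t_N, oo)) ~ (2 pi)^d gamma_d prod_j (a_j eps_N / 2)^{1/2} as N
   tends to infinity among the admissible integers. A ratio close to 1 forces
   the volume to be finite, so that [fine] loses nothing. *)
Definition rescaled_law (tN epsN : nat -> R) : Prop :=
  fine (sigmaNk N (multi_index N) `[tN N, +oo[) /
    ((2 * pi) ^+ d * unit_ball_volume d *
       \prod_j Num.sqrt (a 0 j * epsN N / 2))
  @[N --> within admissible \oo] --> (1 : R).

End Laws.

(* Main.v *)
Require Import Defs.
From mathcomp Require Import all_boot all_order all_algebra.
From mathcomp Require Import complex.
From mathcomp Require Import all_classical all_reals all_analysis.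
From mathcomp Require Import measurable_realfun.
From mathcomp Require Import ring lra.

Set Implicit Arguments.
Unset Strict Implicit.
Unset Printing Implicit Defensive.

Import Order.TTheory GRing.Theory Num.Theory.
Import numFieldNormedType.Exports.

Local Open Scope classical_set_scope.
Local Open Scope ring_scope.

(** Put [r_j = |z_j|^2] and [k = N a]. The density [|z^k|^2 e^{- N |z|^2}] is a
    product of factors [r^{N a} e^{- N r}], each maximal at [r = a], so that
    [<s_k, s_k>(z)] equals a constant depending on [N] times
    [exp (- N sum_j a_j h (r_j / a_j - 1))] with [h v = v - ln (1 + v)]
    ([sk_norm2E]). The set whose volume is measured is therefore a sublevel set
    of [sum_j a_j h (r_j / a_j - 1)], at the level
    [delta_N = (- ln t_N + (d / 2) ln N - gamma + o(1)) / N]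
    ([sigmaNk_sublevel]). The term [(d / 2) ln N - gamma] comes from the
    normalizing constant, whose factors are the integrals of
    [r^{N a} e^{- N r}] over the half-line, evaluated by Laplace's method
    ([laplace_gamma]).

    In each of the three regimes [delta_N] tends to [0] and is equivalent to
    [eps_N]. Near [0] the function [h v] is [v^2 / 2] up to a factor tending to
    [1] ([entropy_lb], [entropy_ub]), so the sublevel set lies between two sets
    [sum_j (r_j - a_j)^2 / (2 a_j) <= delta_N (1 -+ kappa_N)] with [kappa_N]
    tending to [0] ([sum_entropy_le], [sum_quadratic_le]). These are
    ellipsoids in the coordinates [r_j], and [z |-> |z|^2] carries planar
    Lebesgue measure to [pi] times Lebesgue measure on the half-line
    ([lebesgue2_sqnorm]); hence their volume is
    [gamma_d prod_j pi sqrt (2 a_j delta_N (1 -+ kappa_N))]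
    ([volume_quadratic_sublevel]), and
    [pi sqrt (2 a_j delta) = 2 pi sqrt (a_j delta / 2)] gives the formula.
    What is left ([rescaled_law_criterion]) is to compare [delta_N] with
    [eps_N] in each regime. *)

(** * Iterated product measures *)

Section PowerMeasure.
Local Open Scope ereal_scope.
Context {d1 : measure_display} {T : measurableType d1} {R : realType}.
Variable mu : {sigma_finite_measure set T -> \bar R}.

Lemma power_measureS n (A : set (n.+1.-tuple T)) :
  power_measure mu n.+1 A =
  \int[mu]_x power_measure mu n ((fun t => tcons (x, t)) @^-1` A).
Proof.
apply: eq_integral => x _ /=; congr (power_measure mu n _).
by apply/seteqP; split => t; rewrite /xsection /= inE.
Qed.

Lemma measurable_power_slice n (A : set (n.+1.-tuple T)) : measurable A ->
  measurable_fun [set: T]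
    ((fun x => power_measure mu n ((fun t => tcons (x, t)) @^-1` A)) : T -> \bar R).
Proof.
move=> mA.
have mB : measurable (@tcons _ T n @^-1` A).
  by rewrite -[X in measurable X]setTI; exact: measurable_tcons.
have := measurable_fun_xsection (power_measure mu n) mB.
apply: eq_measurable_fun => x _ /=; congr (power_measure mu n _).
by apply/seteqP; split => t; rewrite /xsection /= inE.
Qed.

Lemma measurable_slice n (A : set (n.+1.-tuple T)) x : measurable A ->
  measurable ((fun t => tcons (x, t)) @^-1` A).
Proof.
move=> mA; rewrite -[X in measurable X]setTI.
have m : measurable_fun [set: n.-tuple T] (fun t => tcons (x, t)).
  exact: (measurable_cons (@measurable_cst _ _ _ _ setT x) (@measurable_id _ _ setT)).
exact: m.
Qed.

Lemma ge0_integral_powerS n (f : n.+1.-tuple T -> \bar R) :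
  measurable_fun setT f -> (forall t, 0 <= f t) ->
  \int[power_measure mu n.+1]_t f t =
  \int[mu]_x \int[power_measure mu n]_t f (tcons (x, t)).
Proof.
move=> mf f0.
transitivity (\int[pushforward (mu \x power_measure mu n)%E (@tcons _ T n)]_t f t).
  by [].
rewrite ge0_integral_pushforward//; last exact: measurable_tcons.
rewrite preimage_setT fubini_tonelli1//=.
by apply: measurableT_comp => //; exact: measurable_tcons.
Qed.

Lemma tnth_tcons0 n x (t : n.-tuple T) : tnth (tcons (x, t)) ord0 = x.
Proof. by []. Qed.

Lemma tnth_tconsS n x (t : n.-tuple T) j :
  tnth (tcons (x, t)) (lift ord0 j) = tnth t j.
Proof. by rewrite tnthS; congr tnth; exact: val_inj. Qed.

(** Tonelli along the recursive construction of the power measure. *)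
Lemma integral_power_prod n (g : 'I_n -> T -> R) (c : 'I_n -> R) :
  (forall j, measurable_fun setT (g j)) -> (forall j x, (0 <= g j x)%R) ->
  (forall j, \int[mu]_x (g j x)%:E = (c j)%:E) ->
  \int[power_measure mu n]_t (\prod_(j < n) g j (tnth t j))%:E =
  (\prod_(j < n) c j)%:E.
Proof.
elim: n g c => [|n IH] g c mg g0 gc.
  under eq_integral do rewrite big_ord0.
  rewrite big_ord0 /= integral_dirac//.
  by rewrite mule1 diracT.
have c0 j : (0 <= c j)%R.
  by rewrite -lee_fin -gc; apply: integral_ge0 => x _; rewrite lee_fin.
rewrite ge0_integral_powerS; last 2 first.
- apply/measurable_EFinP; apply: measurable_prod => j _.
  by apply: measurableT_comp => //; exact: measurable_tnth.
- by move=> t; rewrite lee_fin prodr_ge0.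
rewrite (eq_integral (fun x => (g ord0 x)%:E *
    (\prod_(j < n) c (lift ord0 j))%:E)).
  rewrite ge0_integralZr//; first by rewrite gc -EFinM big_ord_recl.
  - exact/measurable_EFinP.
  - by move=> x _; rewrite lee_fin.
  - by rewrite lee_fin prodr_ge0.
move=> x _.
under eq_integral.
  move=> t _; rewrite big_ord_recl tnth_tcons0.
  under eq_bigr do rewrite tnth_tconsS.
  rewrite EFinM; over.
rewrite ge0_integralZl//.
- by rewrite (IH (fun j => g (lift ord0 j)) (fun j => c (lift ord0 j))).
- apply/measurable_EFinP; apply: measurable_prod => j _.
  by apply: measurableT_comp => //; exact: measurable_tnth.
- by move=> t _; rewrite lee_fin prodr_ge0.
- by rewrite lee_fin.
Qed.

End PowerMeasure.

Section PowerPushforward.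
Local Open Scope ereal_scope.
Context {d1 d2 : measure_display} {T : measurableType d1}
  {U : measurableType d2} {R : realType}.
Variables (mu : {sigma_finite_measure set T -> \bar R})
  (nu : {sigma_finite_measure set U -> \bar R}).

(** Change of variables for a map that scales measure by a constant factor
    over [K]. Since [f] vanishes off [K], both integrals are integrals over [K]
    for two measures, the image of [mu] and a multiple of [nu], that agree
    there. *)
Lemma ge0_integral_comp_scaled (phi : T -> U) (K : set U) (c : R) (f : U -> \bar R) :
  measurable_fun setT phi -> measurable K -> (0 <= c)%R ->
  (forall B, measurable B -> B `<=` K -> mu (phi @^-1` B) = c%:E * nu B) ->
  measurable_fun setT f -> (forall y, 0 <= f y) -> (forall y, ~ K y -> f y = 0) ->
  \int[mu]_x f (phi x) = c%:E * \int[nu]_y f y.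
Proof.
move=> mphi mK c0 muK mf f0 fK.
have fE : f = f \_ K.
  by apply/funext => y; rewrite patchE; case: ifPn => // /negP; rewrite inE => /fK.
have -> : \int[nu]_y f y = \int[nu]_(y in K) f y by rewrite [in RHS]integral_mkcond -fE.
rewrite -[LHS](ge0_integral_pushforward mphi _ measurableT)//.
rewrite [in LHS]fE -integral_mkcond.
have -> : \int[pushforward mu phi]_(y in K) f y =
    \int[mscale (NngNum c0) nu]_(y in K) f y.
  by apply: eq_measure_integral => // B mB BK; exact: muK.
by rewrite ge0_integral_mscale//; exact: measurable_funTS.
Qed.

(** If every coordinate map scales measure by [c j], the product map scales
    volume by the product of the [c j], by induction on the number of
    coordinates. The set [K] is there because a map that is affine in the
    squared modulus of a complex number scales measure only over the part of
    the line that corresponds to nonnegative squared moduli. *)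
Lemma power_measure_preimage n (phi : 'I_n -> T -> U) (K : set U) (c : 'I_n -> R)
    (A : set (n.-tuple U)) :
  (forall j, measurable_fun setT (phi j)) -> measurable K ->
  (forall j, (0 <= c j)%R) ->
  (forall j B, measurable B -> B `<=` K ->
     mu (phi j @^-1` B) = (c j)%:E * nu B) ->
  measurable A -> (forall t, A t -> forall j, K (tnth t j)) ->
  power_measure mu n [set t | A [tuple phi j (tnth t j) | j < n]] =
  (\prod_(j < n) c j)%:E * power_measure nu n A.
Proof.
move=> mphi mK + + mA AK; elim: n phi c A mphi mA AK => [|n IH] phi c A mphi mA AK c0 muK.
  rewrite big_ord0 mul1e /= !diracE; congr (_%:R%:E); congr nat_of_bool.
  apply/idP/idP; rewrite !inE /=; suff -> : [tuple phi j (tnth [tuple] j) | j < 0] = [tuple] by [].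
    by apply: eq_from_tnth; case.
  by apply: eq_from_tnth; case.
rewrite !power_measureS big_ord_recl EFinM -muleA.
pose H y := (\prod_(j < n) c (lift ord0 j))%:E *
  power_measure nu n ((fun t => tcons (y, t)) @^-1` A).
transitivity (\int[mu]_x H (phi ord0 x)).
  apply: eq_integral => x _.
  rewrite /H -(IH (fun j => phi (lift ord0 j)) (fun j => c (lift ord0 j)) _
    (fun j => mphi (lift ord0 j)) (measurable_slice _ mA) _
    (fun j => c0 (lift ord0 j)) (fun j => @muK (lift ord0 j))); last first.
    by move=> t At j; have := AK _ At (lift ord0 j); rewrite tnth_tconsS.
  congr (power_measure mu n _); apply/funext => t /=; congr A.
  apply: eq_from_tnth => j; rewrite tnth_mktuple.
  have [j' ->|->] := unliftP ord0 j; last by rewrite !tnth_tcons0.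
  by rewrite !tnth_tconsS tnth_mktuple.
have P0 : (0 <= \prod_(j < n) c (lift ord0 j))%R by exact: prodr_ge0.
have mH := measurable_power_slice nu mA.
rewrite (@ge0_integral_comp_scaled _ K (c ord0) H)//.
- by rewrite /H ge0_integralZl.
- exact: muK.
- by rewrite /H; apply: emeasurable_funM => //; exact: measurable_cst.
- by move=> y; rewrite /H mule_ge0.
- move=> y Ky; rewrite /H (_ : _ @^-1` A = set0) ?measure0 ?mule0//.
  by rewrite -subset0 => t /= At; apply: Ky; have := AK _ At ord0; rewrite tnth_tcons0.
Qed.

End PowerPushforward.

(** * Affine maps of the line *)

Section LebesgueAffine.
Local Open Scope ereal_scope.
Context {R : realType}.
Local Notation mR := (measurableTypeR R).
Local Notation leb := (@lebesgue_measure R).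

Lemma measurable_affine (s b : R) :
  measurable_fun [set: mR] ((fun x => (s * x + b)%R) : mR -> mR).
Proof. by apply: measurable_funD => //; exact: measurable_funM. Qed.

Lemma lebesgue_measure_affine (s b : R) (A : set mR) : (0 < s)%R -> measurable A ->
  leb ((fun x : mR => (s * x + b)%R : mR) @^-1` A) = (s^-1)%:E * leb A.
Proof.
move=> s0 mA; pose phi : mR -> mR := fun x => (s * x + b)%R.
have mphi : measurable_fun [set: mR] phi by exact: measurable_affine.
have s0' : (0 <= s)%R by exact: ltW.
rewrite (@lebesgue_measure_unique R (mscale (NngNum s0') (pushforward leb phi)) _ _ mA).
  by rewrite /mscale /= muleA -EFinM mulVf ?gt_eqF// mul1e.
move=> _ [[x y]] _ <-.
change (leb `]x, y]%classic = s%:E * leb (phi @^-1` `]x, y]%classic)).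
rewrite (_ : phi @^-1` _ = `]((x - b) / s)%R, ((y - b) / s)%R]%classic); last first.
  apply/seteqP; split => z /=; rewrite !in_itv/= ltr_pdivrMr// ler_pdivlMr//;
    by rewrite /phi ltrBlDr lerBrDr mulrC.
rewrite !lebesgue_measure_itv/= !lte_fin ltr_pM2r ?invr_gt0// ltrD2r.
case: ifP => _; last by rewrite mule0.
by rewrite -!EFinD -EFinM; congr EFin; field; rewrite gt_eqF.
Qed.

Lemma ge0_integral_affine (s b : R) (f : mR -> \bar R) : (0 < s)%R ->
  measurable_fun setT f -> (forall x, 0 <= f x) ->
  \int[leb]_x f ((s * x + b)%R : mR) = (s^-1)%:E * \int[leb]_x f x.
Proof.
move=> s0 mf f0.
apply: (@ge0_integral_comp_scaled _ _ _ _ _ leb leb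
  (fun x : mR => (s * x + b)%R : mR) setT (s^-1)%R f) => //.
- exact: measurable_affine.
- by rewrite invr_ge0 ltW.
- by move=> B mB _; exact: lebesgue_measure_affine.
- by move=> y /(_ I).
Qed.

End LebesgueAffine.

(** * The squared modulus on the plane *)

Section Disc.
Local Open Scope ereal_scope.
Context {R : realType}.
Local Notation mR := (measurableTypeR R).
Local Notation leb := (@lebesgue_measure R).
Local Notation leb2 := (@lebesgue2 R).

Definition sqnorm (z : mR * mR) : mR := (z.1 ^+ 2 + z.2 ^+ 2)%R.

Lemma sqnorm_ge0 z : (0 <= sqnorm z :> R)%R.
Proof. by rewrite addr_ge0 ?sqr_ge0. Qed.

Lemma measurable_sqnorm : measurable_fun setT sqnorm.
Proof. by apply: measurable_funD; apply: measurable_funX. Qed.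

Lemma measurable_disc (r : R) : measurable (sqnorm @^-1` `]-oo, r[).
Proof.
rewrite -[X in measurable X]setTI; exact: measurable_sqnorm.
Qed.

Lemma disc_scaling (c : R) : (0 < c)%R ->
  leb2 (sqnorm @^-1` `]-oo, (c ^+ 2)%R[) =
  (c ^+ 2)%:E * leb2 (sqnorm @^-1` `]-oo, 1%R[).
Proof.
move=> c0.
have c'0 : (0 < c^-1)%R by rewrite invr_gt0.
have mD := measurable_disc 1.
pose H x := leb (xsection (sqnorm @^-1` `]-oo, 1%R[) x).
have H0 x : 0 <= H x by [].
have mH : measurable_fun setT H by exact: measurable_fun_xsection.
transitivity (\int[leb]_x (c%:E * H (c^-1 * x + 0)%R)).
  apply: eq_integral => x _ /=.
  rewrite /H -[c in c%:E]invrK -(@lebesgue_measure_affine R c^-1 0)//; last first.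
    exact: measurable_xsection.
  congr (leb _); apply/seteqP; split => y; rewrite /xsection /= !inE /= !in_itv /= /sqnorm /= => h.
    rewrite !addr0 !exprMn -mulrDr exprVn mulrC ltr_pdivrMr ?exprn_gt0// mul1r//.
  by move: h; rewrite !addr0 !exprMn -mulrDr exprVn mulrC ltr_pdivrMr ?exprn_gt0// mul1r.
rewrite ge0_integralZl//; last 2 first.
- by apply: measurableT_comp => //; exact: measurable_affine.
- by rewrite lee_fin ltW.
by rewrite ge0_integral_affine// invrK muleA -EFinM -expr2.
Qed.

(** The area of the unit disc, not yet known to be [pi]. *)
Let C := leb2 (sqnorm @^-1` `]-oo, 1%R[).

Let C_fin : C \is a fin_num.
Proof.
rewrite ge0_fin_numE ?measure_ge0//.
apply: (@le_lt_trans _ _ (leb2 (`[(-1)%R, 1%R] `*` `[(-1)%R, 1%R]))).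
  apply: le_measure; rewrite ?inE.
  - exact: measurable_disc.
  - by apply: measurableX; exact: measurable_itv.
  - move=> [x y]; rewrite /= in_itv /= /sqnorm /= => h; rewrite !in_itv /=; split; nra.
by rewrite /lebesgue2 product_measure1E//= !lebesgue_measure_itv/= lte_fin gtrN ?ltr01//= -!EFinD -EFinM ltry.
Qed.

(** By scaling, the disc where the squared modulus is below [r] has area
    [C * r], and half-lines generate the Borel sets. *)
Let lebesgue2_sqnormC (B : set mR) : measurable B ->
  leb2 (sqnorm @^-1` B) = C * leb (B `&` `[0%R, +oo[).
Proof.
move=> mB.
have C0 : (0 <= fine C)%R by rewrite fine_ge0// measure_ge0.
have m0 : measurable (`[0%R, +oo[ : set mR) by exact: measurable_itv.
pose m1 : {measure set mR -> \bar R} :=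
  measure_function_pushforward__canonical__measure_function_Measure leb2
    measurable_sqnorm.
pose m2 : {measure set mR -> \bar R} := mscale (NngNum C0) (mrestr leb m0).
rewrite -(fineK C_fin); change (m1 B = m2 B).
have disc r : leb2 (sqnorm @^-1` `]-oo, r[) = (fine C)%:E * leb (`]-oo, r[ `&` `[0%R, +oo[).
  have [r0|r0] := leP r 0%R.
    have -> : sqnorm @^-1` `]-oo, r[ = set0.
      by rewrite -subset0 => x /=; rewrite in_itv/=; have := sqnorm_ge0 x; lra.
    have -> : `]-oo, r[ `&` `[0%R, +oo[ = set0 :> set mR.
      by rewrite -subset0 => x /=; rewrite !in_itv/= andbT => -[]; lra.
    by rewrite !measure0 mule0.
  have -> : `]-oo, r[ `&` `[0%R, +oo[ = `[0%R, r[%classic :> set mR.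
    by apply/seteqP; split => x /=; rewrite !in_itv/= ?andbT; [case=> -> ->|case/andP=> -> ->].
  rewrite -[in LHS](sqr_sqrtr (ltW r0)) disc_scaling ?sqrtr_gt0// sqr_sqrtr ?ltW//.
  rewrite fineK// muleC; congr (_ * _).
  by rewrite lebesgue_measure_itv/= lte_fin r0 oppr0 adde0.
refine (@measure_unique _ R mR (@RGenInftyO.G R) (fun n => `]-oo, n%:R[%classic)
  _ _ _ _ m1 m2 _ _ B mB).
- exact: RGenInftyO.measurableE.
- move=> _ _ [x ->] [y ->]; exists (Num.min x y).
  by apply/seteqP; split => z /=; rewrite !in_itv/= lt_min; [case=> -> ->|case/andP=> -> ->].
- by move=> n; exists n%:R.
- rewrite -subTset => x _; exists (Num.truncn `|x|).+1 => //=; rewrite in_itv/=.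
  by rewrite (le_lt_trans (ler_norm x))// truncnS_gt.
- by move=> _ [x ->]; exact: disc.
(* [disc_scaling] needs the bound on the squared modulus to be a square. *)
- move=> n; change (leb2 (sqnorm @^-1` `]-oo, n%:R[) < +oo).
  apply: (@le_lt_trans _ _ (leb2 (sqnorm @^-1` `]-oo, (n.+1%:R ^+ 2)%R[))).
    apply: le_measure; rewrite ?inE; [exact: measurable_disc..|].
    move=> z /=; rewrite !in_itv/= => /lt_le_trans; apply.
    by rewrite -natrX ler_nat (leq_trans (leqnSn n))// leq_pmulr.
  by rewrite disc_scaling// -/C -(fineK C_fin) -EFinM ltry.
Qed.

Let integral_sqnormC (f : mR -> \bar R) :
  measurable_fun setT f -> (forall x : R, (0 <= x)%R -> 0 <= f x) ->
  \int[leb2]_z f (sqnorm z) = C * \int[leb]_(r in `[0%R, +oo[) f r.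
Proof.
move=> mf f0.
have m0 : measurable (`[0%R, +oo[ : set mR) by exact: measurable_itv.
rewrite [in RHS]integral_mkcond -[C in RHS]fineK//.
rewrite -(@ge0_integral_comp_scaled _ _ _ _ _ leb2 leb sqnorm `[0%R, +oo[ (fine C))//.
- apply: eq_integral => z _; rewrite patchE mem_set//=.
  by rewrite in_itv/= sqnorm_ge0.
- exact: measurable_sqnorm.
- by rewrite fine_ge0// measure_ge0.
- move=> B mB BK; rewrite fineK//; apply: (etrans (lebesgue2_sqnormC mB)).
  by congr (_ * leb _); exact/setIidPl.
- by apply/measurable_restrict => //; exact: measurable_funTS.
- move=> y; rewrite patchE; case: ifPn => //.
  by rewrite inE/= in_itv/= andbT; exact: f0.
- by move=> y Ky; rewrite patchE memNset.
Qed.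

(** The integral of [exp (- |z|^2)] over the plane is [C] times the integral
    of [exp (- r)] over [r >= 0], that is [C]; by Tonelli it is also the square
    of the Gauss integral. *)
Let C_pi : C = pi%:E.
Proof.
have : \int[leb2]_z (expR (- sqnorm z))%:E = C * \int[leb]_(r in `[0%R, +oo[) (expR (- r))%:E.
  rewrite (@integral_sqnormC (fun r => (expR (- r))%:E))//.
  by apply/measurable_EFinP; apply: measurableT_comp => //; exact: measurableT_comp.
rewrite (_ : \int[leb]_(r in `[0%R, +oo[) _ = 1); last first.
  rewrite -(@integral_exponential_pdf R 1 ltr01) [LHS]integral_mkcond.
  apply: eq_integral => x _; rewrite /exponential_pdf !patchE.
  by case: ifP => // _; rewrite mulN1r mul1r.
rewrite mule1 => <-; rewrite fubini_tonelli1; last 2 first.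
- apply/measurable_EFinP; apply: measurableT_comp => //; apply: measurableT_comp => //.
  exact: measurable_sqnorm.
- by move=> z; rewrite lee_fin expR_ge0.
have mg : measurable_fun setT (EFin \o @gauss_fun R).
  by apply/measurable_EFinP; exact: measurable_gauss_fun.
have g0 (x : R) : 0 <= (gauss_fun x)%:E by rewrite lee_fin gauss_fun_ge0.
transitivity (\int[leb]_x ((gauss_fun x)%:E * (Num.sqrt pi)%:E)).
  apply: eq_integral => x _; rewrite /fubini_F /=.
  rewrite -(@integralT_gauss R) -ge0_integralZl//.
  by apply: eq_integral => y _; rewrite -EFinM -expRD /sqnorm /= opprD.
rewrite ge0_integralZr//.
by rewrite integralT_gauss -EFinM -expr2 sqr_sqrtr// pi_ge0.
Qed.

(** Polar coordinates with the angle integrated out: the squared modulus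
    carries planar Lebesgue measure to [pi] times Lebesgue measure on the
    half-line. *)
Lemma lebesgue2_sqnorm (B : set mR) : measurable B ->
  leb2 (sqnorm @^-1` B) = pi%:E * leb (B `&` `[0%R, +oo[).
Proof. by rewrite -C_pi; exact: lebesgue2_sqnormC. Qed.

Lemma ge0_integral_sqnorm (f : mR -> \bar R) :
  measurable_fun setT f -> (forall x : R, (0 <= x)%R -> 0 <= f x) ->
  \int[leb2]_z f (sqnorm z) = pi%:E * \int[leb]_(r in `[0%R, +oo[) f r.
Proof. by rewrite -C_pi; exact: integral_sqnormC. Qed.

End Disc.

(** * Two-sided bounds for v - ln (1 + v) *)

Section LogBounds.
Context {R : realType}.
Implicit Types u v : R.

Lemma ge0_is_derive_homo (f df : R -> R) :
  (forall u, 0 < u -> is_derive u 1 f (df u)) -> (forall u, 0 < u -> 0 <= df u) ->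
  forall u v, 0 < u -> u <= v -> f u <= f v.
Proof.
move=> fdf df0 u v u0 uv.
have [||w wuv] := @MVT_segment R f df u v uv.
- by move=> x; rewrite in_itv/= => /andP[ux _]; apply: fdf; exact: lt_trans ux.
- apply: derivable_within_continuous => x; rewrite in_itv/= => /andP[ux _].
  have x0 : 0 < x by exact: lt_le_trans ux.
  by have [] := fdf _ x0.
rewrite -subr_ge0 => ->; rewrite mulr_ge0 ?subr_ge0//; apply: df0.
by move: wuv; rewrite in_itv/= => /andP[uw _]; exact: lt_le_trans uw.
Qed.

(* With [w = ln u], [g u = sinh w - w]; [q] is the error of the second-order
   Taylor polynomial of [ln] at [1]. Both vanish at [1] and are nondecreasing,
   so that each bounds [ln u] on either side of [1]. *)
Let g u := 2^-1 * (u - u^-1) - ln u.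
Let q u := ln u - (u - 1) + 2^-1 * (u - 1) ^+ 2.

Let g_homo u v : 0 < u -> u <= v -> g u <= g v.
Proof.
apply: (@ge0_is_derive_homo g (fun u => (1 - u^-1) ^+ 2 / 2)) => {u v} u u0; last first.
  by rewrite divr_ge0// sqr_ge0.
have un0 : u != 0 by rewrite gt_eqF.
have dg : is_derive u 1 g _ := is_deriveB (is_deriveZ 2^-1
  (is_deriveB (is_derive_id u 1) (is_deriveV un0 (is_derive_id u 1))))
  (is_derive1_ln u0).
apply: (is_derive_eq dg).
rewrite /GRing.scale /=; field.
by rewrite un0.
Qed.

Let q_homo u v : 0 < u -> u <= v -> q u <= q v.
Proof.
apply: (@ge0_is_derive_homo q (fun u => (u - 1) ^+ 2 / u)) => {u v} u u0; last first.
  by rewrite divr_ge0 ?sqr_ge0// ltW.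
have un0 : u != 0 by rewrite gt_eqF.
have d1 := is_deriveB (is_derive_id u 1) (is_derive_cst (1 : R) u 1).
have dq : is_derive u 1 q _ := is_deriveD (is_deriveB (is_derive1_ln u0) d1)
  (is_deriveZ 2^-1 (is_deriveX 2 d1)).
apply: (is_derive_eq dq).
rewrite /GRing.scale /= !fctE /=; field.
by rewrite un0.
Qed.

Let g1 : g 1 = 0. Proof. by rewrite /g invr1 subrr mulr0 ln1 subr0. Qed.
Let q1 : q 1 = 0. Proof. by rewrite /q ln1 !subrr expr0n mulr0 addr0. Qed.

(** The relative entropy per unit mass: with [r = a * (1 + v)],
    [a * entropy v = (r - a) - a * ln (r / a)]. *)
Definition entropy v : R := v - ln (1 + v).

Let entropy_gE v : -1 < v -> entropy v = v ^+ 2 / (2 * (1 + v)) + g (1 + v).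
Proof. by move=> v1; rewrite /entropy /g; field; lra. Qed.

Let entropy_qE v : entropy v = v ^+ 2 / 2 - q (1 + v).
Proof. by rewrite /entropy /q; field. Qed.

(** For [v >= 0] this is [g >= 0] at [1 + v], for [v < 0] it follows from
    [q <= 0] there. It holds on the whole domain of [entropy], which bounds the
    sublevel sets and provides an integrable majorant in the Laplace
    integral. *)
Lemma entropy_lb v : -1 < v -> v ^+ 2 / (2 * (1 + `|v|)) <= entropy v.
Proof.
move=> v1; have [v0|v0] := leP 0 v.
  rewrite ger0_norm// entropy_gE// lerDl -g1; apply: g_homo; lra.
rewrite entropy_qE.
have : q (1 + v) <= 0 by rewrite -q1; apply: q_homo; lra.
have : v ^+ 2 / (2 * (1 + `|v|)) <= v ^+ 2 / 2.
  apply: ler_wpM2l; first exact: sqr_ge0.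
  have := normr_ge0 v.
  by move=> ?; rewrite lef_pV2 ?posrE; lra.
lra.
Qed.

(** For [v >= 0] this follows from [q >= 0] at [1 + v], for [v < 0] it is
    [g <= 0] there. *)
Lemma entropy_ub v : `|v| < 1 -> entropy v <= v ^+ 2 / (2 * (1 - `|v|)).
Proof.
move=> v1; have [v0|v0] := leP 0 v.
  rewrite entropy_qE.
  have : 0 <= q (1 + v) by rewrite -[leLHS]q1; apply: q_homo; lra.
  have : v ^+ 2 / 2 <= v ^+ 2 / (2 * (1 - `|v|)).
    apply: ler_wpM2l; first exact: sqr_ge0.
    have := normr_ge0 v.
    by move=> ?; rewrite lef_pV2 ?posrE; lra.
  lra.
move: v1; rewrite ltr0_norm// opprK => v1.
rewrite entropy_gE; last lra.
by rewrite gerDl -[leRHS]g1; apply: g_homo; lra.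
Qed.

Lemma expR_entropy u : 0 < u -> u * expR (1 - u) = expR (- entropy (u - 1)).
Proof.
move=> u0; rewrite /entropy (_ : 1 + (u - 1) = u); last by ring.
by rewrite opprB [RHS]expRD lnK ?posrE// opprB.
Qed.

End LogBounds.

(** * Laplace asymptotics of the Gamma integral *)

Section Laplace.
Context {R : realType}.
Local Notation mR := (measurableTypeR R).
Local Notation leb := (@lebesgue_measure R).

Let phi u : R := u * expR (1 - u).

Let phi_ge0 u : 0 <= u -> 0 <= phi u.
Proof. by move=> u0; rewrite mulr_ge0 ?expR_ge0. Qed.

Let F (k : nat) : mR -> R := (fun u : mR => phi u ^+ k) \_ `[0, +oo[.

Let F_ge0 k u : 0 <= F k u.
Proof.
rewrite /F patchE; case: ifPn => //; rewrite inE/= in_itv/= andbT => u0.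
by rewrite exprn_ge0// phi_ge0.
Qed.

Let measurable_F k : measurable_fun setT (F k).
Proof.
apply/measurable_restrict => //; apply: measurable_funTS.
apply: measurable_funX; apply: measurable_funM => //.
by apply: measurableT_comp => //; exact: measurable_funB.
Qed.

(** The integrable majorant: after the substitution [u = 1 + x / sqrt k]
    the exponent [k * entropy (u - 1)] is, for [u > 0], at least
    [x^2 / (2 * (1 + |x| / sqrt k))], and [x^2 / (1 + |x|) >= |x| - 1]. *)
Let dom (x : R) : R := expR (2^-1) * expR (- `|x| / 2).

Let F_entropy k (u : mR) : 0 < u -> F k u = expR (- (k%:R * entropy (u - 1))).
Proof.
move=> u0; rewrite /F patchE mem_set; last by rewrite /= in_itv/= andbT ltW.
by rewrite /phi expR_entropy// -expRM_natl mulrN.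
Qed.

Let sq k : R := Num.sqrt k.+1%:R.

Let sq_ge1 k : 1 <= sq k.
Proof. by rewrite -[leLHS]sqrtr1 ler_sqrt ?ler1n. Qed.

Let sq_gt0 k : 0 < sq k. Proof. exact: lt_le_trans (sq_ge1 k). Qed.

(** The substituted integrand; the index is shifted so that [sqrt k.+1] does
    not vanish. *)
Let f_ k (x : mR) : mR := F k.+1 ((sq k)^-1 * x + 1).

Let f_le_dom k x : f_ k x <= dom x.
Proof.
have [u0|u0] := ltP 0 ((sq k)^-1 * x + 1); last first.
  suff -> : f_ k x = 0 by rewrite mulr_ge0 ?expR_ge0.
  rewrite /f_ /F patchE; case: ifPn => //; rewrite inE/= in_itv/= andbT => u1.
  by rewrite (_ : _ + 1 = 0) ?/phi ?mul0r ?expr0n//; apply/le_anti/andP.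
rewrite /f_ F_entropy// /dom -expRD ler_expR addrK.
set v := _^-1 * x.
have v1 : -1 < v by rewrite /v; lra.
have xv : x = sq k * v by rewrite /v mulrA divff ?mul1r// gt_eqF.
have vlb := entropy_lb v1.
have k2 : sq k ^+ 2 = k.+1%:R by rewrite sqr_sqrtr.
rewrite -k2 xv normrM (ger0_norm (ltW (sq_gt0 k))).
have s1 := sq_ge1 k; set s := sq k in s1 *; clearbody s.
have n0 := normr_ge0 v; rewrite -[v ^+ 2]real_normK ?num_real// in vlb.
set w := `|v| in vlb n0 *.
suff : (s * w - 1) / 2 <= s ^+ 2 * (w ^+ 2 / (2 * (1 + w))).
  have : s ^+ 2 * (w ^+ 2 / (2 * (1 + w))) <= s ^+ 2 * entropy v.
    by apply: ler_wpM2l => //; exact: sqr_ge0.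
  lra.
rewrite (_ : s ^+ 2 * _ = s ^+ 2 * w ^+ 2 / (1 + w) / 2); last by field; lra.
rewrite ler_pM2r// ler_pdivlMr; last lra.
have t0 : 0 <= (s - 1) * w by rewrite mulr_ge0// subr_ge0.
nra.
Qed.

Let cvg_sqV (x : R) : (fun k => (sq k)^-1 * x) @ \oo --> (0 : R).
Proof.
rewrite -[X in _ --> X](mul0r x); apply: cvgM; last exact: cvg_cst.
apply/gtr0_cvgV0; first by apply: nearW => k; exact: sq_gt0.
apply/cvgryPge => A; near=> k.
have [A0|A0] := leP A 0; first exact: le_trans (ltW (sq_gt0 _)).
rewrite -(ger0_norm (ltW A0)) -sqrtr_sqr ler_sqrt//.
apply: (@le_trans _ _ k%:R); last by rewrite ler_nat.
by near: k; exact: nbhs_infty_ger.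
Unshelve. all: end_near. Qed.

Let cvg_entropy (x : R) :
  (fun k => k.+1%:R * entropy ((sq k)^-1 * x)) @ \oo --> x ^+ 2 / 2.
Proof.
have cv := cvg_sqV x.
have cn : (fun k => `|(sq k)^-1 * x|) @ \oo --> (0 : R).
  by rewrite -(@normr0 R R); exact: cvg_norm.
have lim (g : nat -> R) : g @ \oo --> (1 : R) ->
    (fun k => x ^+ 2 / (2 * g k)) @ \oo --> x ^+ 2 / 2.
  move=> g1; apply: cvgM; first exact: cvg_cst.
  apply: cvgV => //; rewrite -[X in _ --> X](mulr1 2).
  by apply: cvgM => //; exact: cvg_cst.
apply: (@squeeze_cvgr _ _ _ _ (fun k => x ^+ 2 / (2 * (1 + `|(sq k)^-1 * x|)))
   (fun k => x ^+ 2 / (2 * (1 - `|(sq k)^-1 * x|)))).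
- near=> k.
  have v1 : `|(sq k)^-1 * x| < 1.
    by near: k; apply: (cvgr_lt (0 : R)) => //; exact: ltr01.
  have x2 : x ^+ 2 = k.+1%:R * ((sq k)^-1 * x) ^+ 2.
    by rewrite exprMn exprVn sqr_sqrtr// mulrA divff ?mul1r// pnatr_eq0.
  rewrite x2 -!(mulrA k.+1%:R); apply/andP; split; apply: ler_wpM2l => //.
    by apply: entropy_lb; move: v1; rewrite ltr_norml => /andP[].
  exact: entropy_ub.
- by apply: lim; rewrite -[X in _ --> X](addr0 1); apply: cvgD => //; exact: cvg_cst.
- by apply: lim; rewrite -[X in _ --> X](subr0 1); apply: cvgB => //; exact: cvg_cst.
Unshelve. all: end_near. Qed.


Let f_cvg (x : R) : f_ ^~ x @ \oo --> expR (- (x ^+ 2 / 2)).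
Proof.
have : (fun k => expR (- (k.+1%:R * entropy ((sq k)^-1 * x)))) @ \oo
    --> expR (- (x ^+ 2 / 2)).
  apply: continuous_cvg; first exact: continuous_expR.
  by apply: cvgN; exact: cvg_entropy.
apply: cvg_trans; apply: near_eq_cvg; near=> k.
rewrite /f_ F_entropy ?addrK//.
suff : `|(sq k)^-1 * x| < 1 by rewrite ltr_norml => /andP[]; lra.
near: k; apply: (cvgr_lt (0 : R)) => //.
rewrite -(@normr0 R R); apply: cvg_norm; exact: cvg_sqV.
Unshelve. all: end_near. Qed.

Let continuous_dom : continuous dom.
Proof.
move=> x; apply: cvgM; first exact: cvg_cst.
apply: continuous_comp; last exact: continuous_expR.
apply: cvgM; last exact: cvg_cst.
by apply: cvgN; exact: norm_continuous.
Qed.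

Let integrable_dom : leb.-integrable setT (EFin \o dom).
Proof.
have dom0 x : 0 <= dom x by rewrite mulr_ge0 ?expR_ge0.
have mdom : measurable_fun [set: mR] (EFin \o dom).
  by apply/measurable_EFinP; exact: continuous_measurable_fun.
apply/integrableP; split => //.
under eq_integral do rewrite /= ger0_norm//.
rewrite ge0_symfun_integralT//; last by move=> x; rewrite /= /dom normrN.
rewrite (_ : (\int[leb]_(x in _) _)%E = ((expR 2^-1 * 2)%:E * \int[leb]_x (exponential_pdf 2^-1 x)%:E)%E).
  by rewrite integral_exponential_pdf// mule1 -EFinM ltry.
rewrite -ge0_integralZl//; last 2 first.
- by apply/measurable_EFinP; exact: measurable_exponential_pdf.
- by move=> x _; rewrite lee_fin exponential_pdf_ge0.
rewrite -set_itvcy [LHS]integral_mkcond; apply: eq_integral => x _.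
rewrite /exponential_pdf !patchE; case: ifPn; last by rewrite mule0.
rewrite inE/= in_itv/= andbT => x0; rewrite -EFinM /dom ger0_norm//.
congr EFin; rewrite (_ : - x / 2 = - 2^-1 * x); last by rewrite mulrC mulrN mulNr.
by field.
Qed.

Let measurable_f k : measurable_fun setT (f_ k).
Proof.
by apply: (measurableT_comp (measurable_F _)); exact: measurable_affine.
Qed.

Let f_ge0 k x : 0 <= f_ k x. Proof. exact: F_ge0. Qed.

Let integral_gauss : (\int[leb]_x (expR (- (x ^+ 2 / 2)))%:E = (Num.sqrt (2 * pi))%:E)%E.
Proof.
have s0 : 0 < Num.sqrt 2 :> R by rewrite sqrtr_gt0.
transitivity (\int[leb]_x (EFin \o @gauss_fun R) ((Num.sqrt 2)^-1 * x + 0)%R)%E.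
  apply: eq_integral => x _ /=; rewrite /gauss_fun addr0 exprMn exprVn sqr_sqrtr//.
  by rewrite mulrC.
rewrite (@ge0_integral_affine R _ 0 (EFin \o @gauss_fun R)) ?invr_gt0//; last 2 first.
- by apply/measurable_EFinP; exact: measurable_gauss_fun.
- by move=> x; rewrite lee_fin gauss_fun_ge0.
by rewrite integralT_gauss invrK -EFinM sqrtrM.
Qed.

Let integral_f_cvg :
  (\int[leb]_x (f_ k x)%:E @[k --> \oo] --> (Num.sqrt (2 * pi))%:E)%E.
Proof.
rewrite -integral_gauss.
apply: (@dominated_cvg _ _ _ leb setT measurableT (fun k => EFin \o f_ k) _ (EFin \o dom)) => //.
- by move=> k; apply/measurable_EFinP; exact: measurable_f.
- move=> x _; apply/fine_cvgP; split; first exact: nearW.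
  exact: f_cvg.
- by move=> k x _; rewrite /= ger0_norm// lee_fin.
Qed.

Let integral_F k : (\int[leb]_x (f_ k x)%:E = (sq k)%:E * \int[leb]_x (F k.+1 x)%:E)%E.
Proof.
rewrite -[sq k]invrK.
apply: (@ge0_integral_affine R _ 1 (EFin \o F k.+1)).
- by rewrite invr_gt0.
- by apply/measurable_EFinP; exact: measurable_F.
- by move=> x; rewrite lee_fin.
Qed.

Let integral_f_fin k : (\int[leb]_x (f_ k x)%:E)%E \is a fin_num.
Proof.
rewrite ge0_fin_numE; last by apply: integral_ge0 => x _; rewrite lee_fin.
have /integrableP[_] := integrable_dom; apply: le_lt_trans.
apply: ge0_le_integral => //.
- by move=> x _; rewrite lee_fin.
- by apply/measurable_EFinP; exact: measurable_f.
- apply/measurable_EFinP; apply: measurableT_comp => //.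
  exact: continuous_measurable_fun.
- by move=> x _; rewrite /= lee_fin (le_trans (f_le_dom k x))// ler_norm.
Qed.

(** Stirling's formula in integral form. For [u > 0] the integrand
    [(u * exp (1 - u)) ^ k] equals [exp (- k * entropy (u - 1))], and the
    substitution [u = 1 + x / sqrt k] turns it into a sequence of functions
    converging to the Gaussian [exp (- x^2 / 2)] and dominated by [dom]. *)
Lemma laplace_gamma : exists L : nat -> R,
  L k @[k --> \oo] --> Num.sqrt (2 * pi) /\
  forall k, (0 < k)%N -> (\int[leb]_(u in `[0%R, +oo[) ((u * expR (1 - u)) ^+ k)%:E =
    (L k / Num.sqrt k%:R)%:E)%E.
Proof.
exists (fun k => fine (\int[leb]_x (f_ k.-1 x)%:E)%E); split.
  rewrite -(cvg_shiftS (fun k => fine (\int[leb]_x (f_ k.-1 x)%:E)%E)) /=.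
  by apply: fine_cvg; exact: integral_f_cvg.
move=> [//|k] _.
rewrite integral_mkcond EFinM fineK//= integral_F -/(sq k).
rewrite muleC muleA -EFinM mulVf ?mul1e ?gt_eqF//.
by apply: eq_integral => x _; rewrite /F !patchE; case: ifP.
Qed.

End Laplace.

Lemma measurable_forall (disp : measure_display) (T : measurableType disp)
    (I : finType) (A : I -> set T) :
  (forall i, measurable (A i)) -> measurable [set x | forall i, A i x].
Proof.
move=> mA; rewrite (_ : [set x | _] = \bigcap_(i in setT) A i).
  by apply: fin_bigcap_measurable.
by apply/seteqP; split => x Ax i; [move=> _|]; exact: Ax.
Qed.

(** * The unit ball *)

Section UnitBall.
Context {R : realType} (d : nat).
Local Notation mR := (measurableTypeR R).
Local Notation leb := (@lebesgue_measure R).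

Let ball : set (d.-tuple mR) := [set x | \sum_(j < d) tnth x j ^+ 2 <= 1].

Lemma measurable_unit_ball : measurable ball.
Proof.
have -> : ball = (fun x : d.-tuple mR => \sum_(j < d) tnth x j ^+ 2 : mR) @^-1` `]-oo, 1].
  by apply/seteqP; split => x; rewrite /= in_itv.
have m : measurable_fun setT (fun x : d.-tuple mR => \sum_(j < d) tnth x j ^+ 2 : mR).
  apply: measurable_sum => j; apply: measurable_funX; exact: measurable_tnth.
by rewrite -[X in measurable X]setTI; apply: m => //; exact: measurable_itv.
Qed.

Lemma unit_ball_coord x : ball x -> forall j, `[(-1), 1]%classic (tnth x j : R).
Proof.
move=> bx j /=; rewrite in_itv/= -ler_norml -(@expr_le1 _ 2)// real_normK ?num_real//.
apply: le_trans bx; rewrite (bigD1 j)//= lerDl sumr_ge0// => i _; exact: sqr_ge0.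
Qed.

Let measurable_cube (e : R) :
  measurable [set x : d.-tuple mR | forall j, `[(- e), e]%classic (tnth x j : R)].
Proof.
apply: measurable_forall => j; rewrite -[X in measurable X]setTI.
by apply: measurable_tnth => //; exact: measurable_itv.
Qed.

Let cube_volume (e : R) : 0 <= e ->
  power_measure leb d [set x : d.-tuple mR | forall j, `[(- e), e]%classic (tnth x j : R)]
    = ((2 * e) ^+ d)%:E.
Proof.
move=> e0; set Q := [set x | _].
pose g (j : 'I_d) : mR -> R := \1_(`[- e, e] : set mR).
have mI : measurable (`[- e, e] : set mR) by exact: measurable_itv.
have mg j : measurable_fun setT (g j) by exact: measurable_indic.
have QE : \1_Q = (fun x : d.-tuple mR => \prod_(j < d) g j (tnth x j)) :> (_ -> R).
  apply/funext => x; rewrite indicE; have [/set_mem Qx|/negP Qx] := boolP (x \in Q).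
    by rewrite big1// => j _; rewrite /g indicE mem_set//; exact: Qx.
  have /existsNP[j Qj] : ~ Q x by move=> ?; apply: Qx; rewrite inE.
  by rewrite (bigD1 j)//= {1}/g indicE memNset// mul0r.
rewrite -[Q]setIT -[LHS]integral_indic//; last exact: measurable_cube.
rewrite QE.
rewrite (integral_power_prod (c := fun=> 2 * e))//.
- by rewrite big_const_ord iter_mulr_1.
- move=> j; rewrite /g integral_indic//= setIT lebesgue_measure_itv/= lte_fin.
  rewrite -EFinD opprK -mulr2n mulr_natl; case: ifP => // /negbT; rewrite -leNgt => e1.
  by rewrite (_ : e = 0) ?mul0rn//; apply/le_anti; rewrite e0 andbT; lra.
Qed.

Lemma unit_ball_volumeE :
  power_measure leb d ball = (unit_ball_volume d : R)%:E.
Proof.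
rewrite fineK// ge0_fin_numE ?measure_ge0//.
apply: (@le_lt_trans _ _ (power_measure leb d
    [set x : d.-tuple mR | forall j, `[(- 1), 1]%classic (tnth x j : R)])).
  apply: le_measure; rewrite ?inE; [exact: measurable_unit_ball|exact: measurable_cube|].
  by move=> x bx j; exact: unit_ball_coord.
by rewrite cube_volume// ltry.
Qed.

(** The cube of half-side [1 / (d + 1)] lies in the ball. *)
Lemma unit_ball_volume_gt0 : 0 < unit_ball_volume d :> R.
Proof.
pose e : R := d.+1%:R^-1.
have e0 : 0 < e by rewrite invr_gt0.
have de : d%:R * e <= 1.
  by rewrite ler_pdivrMr// mul1r ler_nat.
rewrite -lte_fin -unit_ball_volumeE.
apply: (@lt_le_trans _ _ (power_measure leb d
    [set x : d.-tuple mR | forall j, `[(- e), e]%classic (tnth x j : R)])).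
  by rewrite cube_volume ?ltW// lte_fin exprn_gt0// mulr_gt0.
apply: le_measure; rewrite ?inE; [exact: measurable_cube|exact: measurable_unit_ball|].
move=> x /= Qx; apply: le_trans de.
rewrite -[d in d%:R]card_ord -sum1_card natr_sum mulr_suml; apply: ler_sum => j _.
have := Qx j; rewrite /= in_itv/= -ler_norml mul1r => xe.
rewrite -[tnth x j ^+ 2]real_normK ?num_real// expr2.
apply: (le_trans _ xe); apply: ler_piMr => //; apply: (le_trans xe).
by rewrite /e invf_le1// ler1n.
Qed.

End UnitBall.

(** * Comparing entropy with its quadratic part *)

Section Sandwich.
Context {R : realType} {d : nat}.
Variables (a : 'I_d -> R) (m delta : R).
Hypotheses (m0 : 0 < m) (ma : forall j, m <= a j).
Hypotheses (delta0 : 0 < delta) (deltam : 4 * delta < m).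

(** When [4 * delta < m <= a j], the inequality [a j * entropy v <= delta] forces
    [|v|] to be at most this quantity, which then bounds the relative error of
    replacing [entropy v] by [v^2 / 2]. *)
Definition sandwich_err : R := 2 * Num.sqrt (delta / m).
Local Notation kappa := sandwich_err.

Let a0 j : 0 < a j. Proof. exact: lt_le_trans (ma j). Qed.

Let kappa2 : kappa ^+ 2 = 4 * (delta / m).
Proof. by rewrite /kappa exprMn sqr_sqrtr ?divr_ge0 ?ltW// expr2 -natrM. Qed.

Lemma sandwich_err_gt0 : 0 < kappa.
Proof. by rewrite mulr_gt0// sqrtr_gt0 divr_gt0. Qed.

Lemma sandwich_err_lt1 : kappa < 1.
Proof.
rewrite -(@expr_lt1 _ 2)// ?ltW ?sandwich_err_gt0// kappa2 mulrA ltr_pdivrMr//.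
by rewrite mul1r.
Qed.

Let delta_a j : 4 * (delta / a j) <= kappa ^+ 2.
Proof. by rewrite kappa2 ler_pM2l// ler_pM2l// lef_pV2// posrE. Qed.

Let entropy_term j (v : R) : -1 < v -> a j * entropy v <= delta ->
  a j * v ^+ 2 / 2 <= (1 + kappa) * (a j * entropy v).
Proof.
move=> v1 hd; have [k0 k1] := (sandwich_err_gt0, sandwich_err_lt1).
have vlb := entropy_lb v1.
have h4 : 4 * entropy v <= kappa ^+ 2.
  apply: le_trans (delta_a j); rewrite ler_pM2l// ler_pdivlMr// mulrC//.
have w0 := normr_ge0 v.
have vw : v ^+ 2 = `|v| ^+ 2 by rewrite real_normK ?num_real.
rewrite vw in vlb *; move: vlb w0; set w := `|v| => vlb w0.
have vlb' : w ^+ 2 <= entropy v * (2 * (1 + w)) by rewrite -ler_pdivrMr//; lra.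
have wk : w <= kappa.
  rewrite leNgt; apply/negP => kw.
  have : w ^+ 2 * 2 <= kappa ^+ 2 * (1 + w) by nra.
  have : kappa ^+ 2 < w ^+ 2 by nra.
  have : kappa ^+ 2 <= kappa by nra.
  nra.
have e0 : 0 <= entropy v by apply: le_trans vlb; rewrite divr_ge0 ?sqr_ge0//; lra.
have ke : 0 <= (kappa - w) * entropy v by rewrite mulr_ge0// subr_ge0.
have : w ^+ 2 / 2 <= (1 + kappa) * entropy v by nra.
by move=> h'; rewrite -mulrA [leRHS]mulrCA; apply: ler_wpM2l => //; exact: ltW.
Qed.

Let entropy_ge0 (v : R) : -1 < v -> 0 <= entropy v.
Proof.
move=> /entropy_lb; by apply: le_trans; rewrite divr_ge0 ?sqr_ge0.
Qed.

(** Each summand is at most [delta], which bounds every [|v j|] by [kappa]; there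
    [v^2 / 2] is at most [(1 + kappa) * entropy v]. *)
Lemma sum_entropy_le (v : 'I_d -> R) : (forall j, -1 < v j) ->
  \sum_j a j * entropy (v j) <= delta ->
  \sum_j a j * v j ^+ 2 / 2 <= (1 + kappa) * delta.
Proof.
move=> v1 hd; have [k0 k1] := (sandwich_err_gt0, sandwich_err_lt1).
have nneg j : 0 <= a j * entropy (v j) by rewrite mulr_ge0 ?entropy_ge0// ltW.
apply: (@le_trans _ _ ((1 + kappa) * \sum_j a j * entropy (v j))).
  rewrite mulr_sumr; apply: ler_sum => j _; apply: entropy_term => //.
  by apply: le_trans hd; rewrite (bigD1 j)//= lerDl sumr_ge0.
by rewrite ler_wpM2l// addr_ge0// ltW.
Qed.

(** The converse inclusion: every [|v j|] is again at most [kappa], and there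
    [(1 - kappa) * entropy v] is at most [v^2 / 2]. *)
Lemma sum_quadratic_le (v : 'I_d -> R) :
  \sum_j a j * v j ^+ 2 / 2 <= (1 - kappa) * delta ->
  (forall j, -1 < v j) /\ \sum_j a j * entropy (v j) <= delta.
Proof.
move=> hd; have [k0 k1] := (sandwich_err_gt0, sandwich_err_lt1).
have nneg j : 0 <= a j * v j ^+ 2 / 2 by rewrite divr_ge0// mulr_ge0 ?sqr_ge0// ltW.
have vk j : `|v j| <= kappa.
  rewrite -(@ler_pXn2r _ 2)// ?nnegrE//; last exact: ltW.
  rewrite real_normK ?num_real//; apply: le_trans (delta_a j).
  have : a j * v j ^+ 2 / 2 <= (1 - kappa) * delta.
    by apply: le_trans hd; rewrite (bigD1 j)//= lerDl sumr_ge0.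
  rewrite mulrA ler_pdivlMr// => h.
  have : 0 <= kappa * delta by rewrite mulr_ge0// ltW.
  nra.
split.
  by move=> j; have := le_lt_trans (vk j) k1; rewrite ltr_norml => /andP[].
have k1' : 0 < 1 - kappa by lra.
rewrite -(ler_pM2l k1'); apply: le_trans hd; rewrite mulr_sumr.
apply: ler_sum => j _.
have v1 := le_lt_trans (vk j) k1.
have := entropy_ub v1; rewrite ler_pdivlMr; last lra.
have e0 : 0 <= entropy (v j).
  by apply: entropy_ge0; move: v1; rewrite ltr_norml => /andP[].
move=> h; have : (1 - kappa) * entropy (v j) <= v j ^+ 2 / 2.
  have := vk j; nra.
by move=> h'; rewrite -mulrA [leLHS]mulrCA; apply: ler_wpM2l => //; exact: ltW.
Qed.

End Sandwich.

(** * Volumes of sublevel sets *)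

Section SublevelVolume.
Context {R : realType} {d : nat}.
Local Notation mR := (measurableTypeR R).
Local Notation leb := (@lebesgue_measure R).
Local Notation leb2 := (@lebesgue2 R).
Variables (a : 'I_d -> R).
Hypothesis a0 : forall j, 0 < a j.

Let rel (x : d.-tuple (mR * mR)) j : R := sqnorm (tnth x j) / a j - 1.

Let measurable_rel j : measurable_fun setT (rel ^~ j).
Proof.
apply: measurable_funB => //; apply: measurable_funM => //.
by apply: measurableT_comp; [exact: measurable_sqnorm|exact: measurable_tnth].
Qed.

Definition entropy_sublevel (delta : R) : set (d.-tuple (mR * mR)) :=
  [set x | (forall j, 0 < sqnorm (tnth x j) :> R) /\
     \sum_j a j * entropy (sqnorm (tnth x j) / a j - 1) <= delta].

Definition quadratic_sublevel (delta : R) : set (d.-tuple (mR * mR)) :=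
  [set x | \sum_j a j * (sqnorm (tnth x j) / a j - 1) ^+ 2 / 2 <= delta].

Let measurable_le (f : d.-tuple (mR * mR) -> R) (c : R) :
  measurable_fun setT f -> measurable [set x | f x <= c].
Proof.
move=> mf; rewrite (_ : [set x | _] = f @^-1` `]-oo, c]).
  by rewrite -[X in measurable X]setTI; apply: mf => //; exact: measurable_itv.
by apply/seteqP; split => x; rewrite /= in_itv.
Qed.

Lemma measurable_quadratic_sublevel delta : measurable (quadratic_sublevel delta).
Proof.
apply: measurable_le; apply: measurable_sum => j; apply: measurable_funM => //.
by apply: measurable_funM => //; apply: measurable_funX; exact: measurable_rel.
Qed.

Lemma measurable_entropy_sublevel delta : measurable (entropy_sublevel delta).
Proof.
apply: measurableI.
  apply: measurable_forall => j.
  rewrite (_ : (fun x => _) = (fun x : d.-tuple (mR * mR) => sqnorm (tnth x j)) @^-1` `]0, +oo[).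
    have m : measurable_fun setT (fun x : d.-tuple (mR * mR) => sqnorm (tnth x j)).
      by apply: measurableT_comp; [exact: measurable_sqnorm|exact: measurable_tnth].
    by rewrite -[X in measurable X]setTI; apply: m => //; exact: measurable_itv.
  by apply/seteqP; split => x; rewrite /= in_itv/= andbT.
apply: measurable_le; apply: measurable_sum => j; apply: measurable_funM => //.
apply: measurable_funB; first exact: measurable_rel.
apply: measurableT_comp => //; apply: measurable_funD => //; exact: measurable_rel.
Qed.

(** The map sending [z j] to [(|z j|^2 - a j) / s j] with
    [s j = sqrt (2 * a j * delta)] pulls the unit ball of [R^d] back to the
    quadratic sublevel set and, in each coordinate, scales measure by
    [pi * s j]. The hypothesis on [delta] says [s j <= a j]: then the interval
    of radius [s j] about [a j] consists of nonnegative numbers, all of them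
    values of the squared modulus. *)
Lemma volume_quadratic_sublevel delta : 0 < delta -> (forall j, 2 * delta <= a j) ->
  lebesgueC (quadratic_sublevel delta) =
  ((\prod_j (pi * Num.sqrt (2 * a j * delta))) * unit_ball_volume d)%:E.
Proof.
move=> delta0 da.
pose s j := Num.sqrt (2 * a j * delta).
have ad0 j : 0 < 2 * a j * delta by rewrite !mulr_gt0.
have s0 j : 0 < s j by rewrite sqrtr_gt0.
have s2 j : s j ^+ 2 = 2 * a j * delta by rewrite sqr_sqrtr// ltW.
have sa j : s j <= a j.
  rewrite -(@ler_pXn2r _ 2)// ?nnegrE ?(ltW (s0 j)) ?(ltW (a0 j))// s2.
  have -> : 2 * a j * delta = a j * (2 * delta) by ring.
  by rewrite expr2 ler_pM2l.
pose phi j (z : mR * mR) : mR := (s j)^-1 * sqnorm z + (- (a j / s j)).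
rewrite EFinM -unit_ball_volumeE.
have mphi j : measurable_fun setT (phi j).
  by apply: (measurableT_comp (measurable_affine _ _)); exact: measurable_sqnorm.
have mK : measurable (`[(- 1)%R, 1%R] : set mR) by exact: measurable_itv.
have c0 j : 0 <= pi * s j by rewrite mulr_ge0 ?pi_ge0// ltW.
rewrite -(@power_measure_preimage _ _ _ _ _ leb2 leb d phi _ (fun j => pi * s j)
  _ mphi mK c0 _ (@measurable_unit_ball R d) (@unit_ball_coord R d)).
  congr (power_measure _ d _); apply/funext => x /=; congr (is_true _).
  under [in RHS]eq_bigr do rewrite tnth_mktuple.
  rewrite -[RHS](ler_pM2l delta0) mulr1 mulr_sumr; congr (_ <= _).
  apply: eq_bigr => j _; rewrite /phi.
  have -> : delta * ((s j)^-1 * sqnorm (tnth x j) + - (a j / s j)) ^+ 2 =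
      delta * (sqnorm (tnth x j) - a j) ^+ 2 / s j ^+ 2.
    by field; rewrite gt_eqF.
  by rewrite s2; field; rewrite !gt_eqF.
move=> j B mB BK.
rewrite [LHS](_ : _ = leb2 (sqnorm @^-1`
    ((fun r : mR => (s j)^-1 * r + - (a j / s j) : mR) @^-1` B)))//.
have mB' : measurable ((fun r : mR => (s j)^-1 * r + - (a j / s j) : mR) @^-1` B).
  by rewrite -[X in measurable X]setTI; exact: measurable_affine.
rewrite lebesgue2_sqnorm// setIidl; last first.
  move=> r /BK /=; rewrite !in_itv/= andbT => /andP[+ _].
  rewrite mulrC -mulrBl ler_pdivlMr// mulN1r => h.
  by have := sa j; lra.
by rewrite lebesgue_measure_affine ?invr_gt0// invrK muleA -EFinM.
Qed.

(** The entropy sublevel set lies between the quadratic ones at the levels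
    [(1 - kappa) * delta] and [(1 + kappa) * delta]. *)
Lemma volume_entropy_sublevel (m delta : R) :
  0 < m -> (forall j, m <= a j) -> 0 < delta -> 4 * delta < m ->
  (\prod_j (pi * Num.sqrt (2 * a j * ((1 - sandwich_err m delta) * delta)))) *
    unit_ball_volume d <= fine (lebesgueC (entropy_sublevel delta))
  <= (\prod_j (pi * Num.sqrt (2 * a j * ((1 + sandwich_err m delta) * delta)))) *
    unit_ball_volume d.
Proof.
move=> m0 ma delta0 deltam.
have k0 := sandwich_err_gt0 m0 delta0.
have k1 := sandwich_err_lt1 m0 delta0 deltam.
set k := sandwich_err m delta in k0 k1 *.
have vol e : 0 < e -> e < 2 -> lebesgueC (quadratic_sublevel (e * delta)) =
    ((\prod_j (pi * Num.sqrt (2 * a j * (e * delta)))) * unit_ball_volume d)%:E.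
  move=> e0 e2; apply: volume_quadratic_sublevel; first by rewrite mulr_gt0.
  move=> j; apply: le_trans (ma j); nra.
have sub : entropy_sublevel delta `<=` quadratic_sublevel ((1 + k) * delta).
  move=> x [x0 hx]; apply: sum_entropy_le => // j.
  by rewrite ltrBDl addrN divr_gt0 ?a0.
have sup : quadratic_sublevel ((1 - k) * delta) `<=` entropy_sublevel delta.
  move=> x hx; have [v1 hd] := sum_quadratic_le m0 ma delta0 deltam hx.
  split => // j; have := v1 j; rewrite ltrBDl addrN => h.
  by have := mulr_gt0 h (a0 j); rewrite mulfVK// gt_eqF.
have mS := measurable_entropy_sublevel delta.
have le1 : (lebesgueC (quadratic_sublevel ((1 - k) * delta)) <=
    lebesgueC (entropy_sublevel delta))%E.
  by apply: le_measure => //; rewrite inE//; exact: measurable_quadratic_sublevel.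
have le2 : (lebesgueC (entropy_sublevel delta) <=
    lebesgueC (quadratic_sublevel ((1 + k) * delta)))%E.
  by apply: le_measure => //; rewrite inE//; exact: measurable_quadratic_sublevel.
have fS : lebesgueC (entropy_sublevel delta) \is a fin_num.
  rewrite ge0_fin_numE ?measure_ge0//; apply: (le_lt_trans le2).
  by rewrite vol ?ltry//; lra.
by rewrite -!lee_fin fineK// -!vol ?le1 ?le2//; lra.
Qed.

End SublevelVolume.

(** * The density and its normalization *)

Section Density.
Context {R : realType}.
Local Notation mR := (measurableTypeR R).
Local Notation leb := (@lebesgue_measure R).
Local Notation leb2 := (@lebesgue2 R).

(* The factors provided by [laplace_gamma]. *)
Variable L : nat -> R.
Hypothesis hL : forall k, (0 < k)%N ->
  (\int[leb]_(u in `[0%R, +oo[) ((u * expR (1 - u)) ^+ k)%:E =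
    (L k / Num.sqrt k%:R)%:E)%E.

(** The substitution [r = a u] moves the maximum of the integrand to [u = 1]. *)
Lemma integral_gamma (N k : nat) (a : R) : (0 < N)%N -> 0 < a -> N%:R * a = k%:R ->
  (\int[leb]_(r in `[0%R, +oo[) (r ^+ k * expR (- (N%:R * r)))%:E =
   (a ^+ k * expR (- k%:R) * (Num.sqrt a / Num.sqrt N%:R * L k))%:E)%E.
Proof.
move=> N0 a0 Na.
have NR0 : 0 < N%:R :> R by rewrite ltr0n.
have k0 : (0 < k)%N by rewrite -(ltr0n R) -Na mulr_gt0.
have m0 : measurable (`[0%R, +oo[ : set mR) by exact: measurable_itv.
pose f : mR -> \bar R := (fun r => (r ^+ k * expR (- (N%:R * r)))%:E) \_ `[0%R, +oo[.
have mf : measurable_fun setT f.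
  apply/measurable_restrict => //; apply: measurable_funTS.
  apply/measurable_EFinP; apply: measurable_funM; first exact: measurable_funX.
  by apply: measurableT_comp => //; apply: measurableT_comp => //; exact: measurable_funM.
have f0 x : (0 <= f x)%E.
  rewrite /f patchE; case: ifPn => //; rewrite inE/= in_itv/= andbT => x0.
  by rewrite lee_fin mulr_ge0 ?expR_ge0// exprn_ge0.
transitivity (\int[leb]_x f x)%E; first by rewrite integral_mkcond.
transitivity (a%:E * \int[leb]_x f (a * x + 0)%R)%E.
  by rewrite ge0_integral_affine// muleA -EFinM mulfV ?gt_eqF// mul1e.
transitivity (a%:E * \int[leb]_(u in `[0%R, +oo[)
    ((a ^+ k * expR (- k%:R))%:E * ((u * expR (1 - u)) ^+ k)%:E))%E.
  congr (_ * _)%E; rewrite [RHS]integral_mkcond; apply: eq_integral => u _.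
  rewrite addr0 /f !patchE !mem_setE !in_itv /= !andbT pmulr_rge0//.
  case: ifP => // _; rewrite -EFinM; congr EFin.
  have -> : - (N%:R * (a * u)) = - k%:R + k%:R * (1 - u) by rewrite mulrA Na; ring.
  by rewrite !exprMn expRD expRM_natl; ring.
rewrite ge0_integralZl//; last 3 first.
- apply: measurable_funTS; apply/measurable_EFinP; apply: measurable_funX.
  apply: measurable_funM => //; apply: measurableT_comp => //; exact: measurable_funB.
- move=> u /=; rewrite in_itv/= andbT => u0.
  by rewrite lee_fin exprn_ge0// mulr_ge0// expR_ge0.
- by rewrite lee_fin mulr_ge0 ?expR_ge0// exprn_ge0// ltW.
rewrite hL// -!EFinM; congr EFin; rewrite -Na sqrtrM ?ler0n//.
set e := a ^+ k * _; have aE : a = Num.sqrt a ^+ 2 by rewrite sqr_sqrtr// ltW.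
rewrite [X in X * _ = _]aE.
by field; rewrite !sqrtr_eq0 -!ltNge a0 NR0.
Qed.

Context {d : nat}.
Implicit Type x : d.-tuple (mR * mR).

Lemma monomial_densityE (N : nat) (k : 'I_d -> nat) x :
  monomial_density N k (complex_point x) =
  \prod_j (sqnorm (tnth x j) ^+ k j * expR (- (N%:R * sqnorm (tnth x j)))).
Proof.
have normc2 (p q : R) : Normc.normc (p +i* q)%C ^+ 2 = p ^+ 2 + q ^+ 2.
  by rewrite /Normc.normc sqr_sqrtr// addr_ge0 ?sqr_ge0.
have normcX (z : R[i]) n : Normc.normc (z ^+ n) = Normc.normc z ^+ n.
  by elim: n => [|n IH]; rewrite ?Normc.normc1// !exprS Normc.normcM IH.
rewrite big_split/= /monomial_density; congr (_ * _).
  rewrite /monomial (big_morph _ (@Normc.normcM R) (@Normc.normc1 R)).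
  rewrite -prodrXl; apply: eq_bigr => j _.
  by rewrite normcX -exprM mulnC exprM mxE normc2.
rewrite -expR_sum sumrN -mulr_sumr; congr (expR (- (_ * _))).
by apply: eq_bigr => j _; rewrite mxE normc2.
Qed.

Variables (a : 'I_d -> R) (N : nat) (k : 'I_d -> nat).
Hypotheses (a0 : forall j, 0 < a j) (N0 : (0 < N)%N).
Hypothesis Na : forall j, N%:R * a j = (k j)%:R.

Let NR0 : 0 < N%:R :> R. Proof. by rewrite ltr0n. Qed.

Let k0 j : (0 < k j)%N.
Proof. by rewrite -(ltr0n R) -Na mulr_gt0. Qed.

Lemma cNk2E : cNk2 N k =
  \prod_j (pi * (a j ^+ k j * expR (- (k j)%:R) *
    (Num.sqrt (a j) / Num.sqrt N%:R * L (k j)))).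
Proof.
rewrite /cNk2 /integralC /Rintegral.
under eq_integral do rewrite monomial_densityE.
have mg j : measurable_fun [set: mR]
    (fun r : mR => r ^+ k j * expR (- (N%:R * r)) : mR).
  apply: measurable_funM; first exact: measurable_funX.
  by apply: measurableT_comp => //; apply: measurableT_comp => //; exact: measurable_funM.
rewrite (integral_power_prod (g := fun j (z : mR * mR) =>
    sqnorm z ^+ k j * expR (- (N%:R * sqnorm z))) (c := fun j => pi *
    (a j ^+ k j * expR (- (k j)%:R) * (Num.sqrt (a j) / Num.sqrt N%:R * L (k j)))))//.
- by move=> j; exact: (measurableT_comp (mg j) measurable_sqnorm).
- by move=> j z; rewrite mulr_ge0 ?expR_ge0// exprn_ge0// sqnorm_ge0.
- move=> j; rewrite EFinM -(integral_gamma N0 (a0 j) (Na j)).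
  rewrite (@ge0_integral_sqnorm R (fun r => (r ^+ k j * expR (- (N%:R * r)))%:E))//.
    by apply/measurable_EFinP; exact: mg.
  by move=> r r0; rewrite lee_fin mulr_ge0 ?expR_ge0// exprn_ge0.
Qed.

(** What remains of the normalizing constant once the maximum of
    [|z^k|^2 e^{- N |z|^2}], attained where [|z_j|^2 = a_j] for all [j], has been
    taken out. *)
Let P := \prod_j (pi * Num.sqrt (a j) / Num.sqrt N%:R * L (k j)).

(** Off the coordinate hyperplanes the normalized density is a multiple of
    [exp (- N * sum_j a_j * entropy (|z_j|^2 / a_j - 1))]: for [k = N a] the
    factors [r^k * exp (- N r)] are powers of [(r / a) * exp (1 - r / a)] up to a
    constant that cancels against [cNk2]. *)
Lemma sk_norm2E x : (forall j, 0 < L (k j)) ->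
  (forall j, 0 < sqnorm (tnth x j) :> R) ->
  sk_norm2 N k (complex_point x) =
  P^-1 * expR (- (N%:R * \sum_j a j * entropy (sqnorm (tnth x j) / a j - 1))).
Proof.
move=> L0 x0; rewrite /sk_norm2 cNk2E monomial_densityE.
rewrite mulr_sumr -sumrN expR_sum /P -!prodfV -!big_split/=.
apply: eq_bigr => j _.
have u0 : 0 < sqnorm (tnth x j) / a j by rewrite divr_gt0.
rewrite [N%:R * (a j * _)]mulrA Na.
rewrite -[- (_ * entropy _)]mulrN [in RHS]expRM_natl -expR_entropy//.
set r : R := sqnorm (tnth x j) in u0 *.
have -> : r ^+ k j * expR (- (N%:R * r)) =
    a j ^+ k j * expR (- (k j)%:R) * (r / a j * expR (1 - r / a j)) ^+ k j.
  have rE : r = a j * (r / a j) by field; rewrite gt_eqF.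
  set u := r / a j in u0 rE *.
  have -> : - (N%:R * r) = - (k j)%:R + (k j)%:R * (1 - u) by rewrite -Na rE; ring.
  by rewrite rE !exprMn expRD expRM_natl; ring.
have e0 : a j ^+ k j * expR (- (k j)%:R) != 0.
  by rewrite gt_eqF// mulr_gt0 ?expR_gt0// exprn_gt0.
set e := a j ^+ k j * _ in e0 *; set w := (_ * _) ^+ _.
have s0 : Num.sqrt (a j) != 0 by rewrite gt_eqF// sqrtr_gt0.
have t0 : Num.sqrt (N%:R : R) != 0 by rewrite gt_eqF// sqrtr_gt0.
have p0 : (pi : R) != 0 by rewrite gt_eqF// pi_gt0.
have l0 : L (k j) != 0 by rewrite gt_eqF.
move: (pi : R) p0 => p p0.
by field; rewrite t0 l0 s0 p0 e0.
Qed.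

(** On the coordinate hyperplanes the density vanishes, since every [k j] is
    positive, so that superlevel sets of the density are exactly sublevel sets
    of the entropy. *)
Lemma sigmaNk_sublevel (t : R) : 0 < t -> (forall j, 0 < L (k j)) ->
  sigmaNk N k `[t, +oo[ = lebesgueC (entropy_sublevel a (- ln (t * P) / N%:R)).
Proof.
move=> t0 L0; rewrite /sigmaNk /volC; congr (lebesgueC _).
have P0 : 0 < P.
  apply: prodr_gt0 => j _; rewrite !mulr_gt0 ?pi_gt0 ?invr_gt0 ?sqrtr_gt0//.
apply/funext => x; rewrite /= in_itv/= andbT /entropy_sublevel /=.
apply/propext; split => [tx|[x0]].
  have x0 j : 0 < sqnorm (tnth x j) :> R.
    rewrite lt_neqAle sqnorm_ge0 andbT; apply/eqP => /esym xj.
    move: tx; rewrite /sk_norm2 monomial_densityE (bigD1 j)//= xj.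
    by rewrite expr0n gtn_eqF// !mul0r mulr0 leNgt t0.
  split=> //; move: tx; rewrite sk_norm2E// mulrC ler_pdivlMr//.
  rewrite -ler_ln ?posrE ?mulr_gt0 ?expR_gt0// expRK ler_pdivlMr//.
  by rewrite lerNr mulrC.
rewrite ler_pdivlMr// => h; rewrite sk_norm2E// [leRHS]mulrC ler_pdivlMr//.
rewrite -ler_ln ?posrE ?mulr_gt0 ?expR_gt0// expRK.
by rewrite lerNr mulrC.
Qed.

End Density.

(** * Asymptotics *)

Section Limits.
Context {R : realType}.

Lemma cvgr_lny : ln (N%:R : R) @[N --> \oo] --> +oo.
Proof.
apply/cvgryPge => A; near=> N.
have N0 : expR A <= N%:R by near: N; exact: nbhs_infty_ger.
by rewrite -ler_expR lnK// posrE (lt_le_trans (expR_gt0 A)).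
Unshelve. all: end_near. Qed.

Lemma cvg_expRN_y (u : nat -> R) : u @ \oo --> +oo -> expR (- u N) @[N --> \oo] --> 0.
Proof. by move=> uy; exact: (cvg_comp _ _ uy (@cvgr_expR R)). Qed.

Lemma cvg_powR_ln (p q : R) : 0 < p \/ p = 0 /\ q < 0 ->
  N%:R `^ (- p) * ln N%:R `^ q @[N --> \oo] --> (0 : R).
Proof.
move=> pq.
suff /cvg_expRN_y : (fun N => p * ln N%:R - q * ln (ln N%:R) : R) @ \oo --> +oo.
  apply: cvg_trans; apply: near_eq_cvg; near=> N.
  have l0 : 0 < ln N%:R :> R.
    by near: N; apply: (cvgry_gt cvgr_lny).
  have N0 : 0 < N%:R :> R by near: N; exact: nbhs_infty_gtr.
  by rewrite /powR !gt_eqF// -expRD; congr expR; ring.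
case: pq => [p0|[-> q0]]; last first.
  have lln : ln (ln N%:R) @[N --> \oo] --> (+oo : set_system R).
    apply/cvgryPge => A; near=> N.
    have h : expR A <= ln N%:R :> R by near: N; exact: (cvgry_ge cvgr_lny).
    by rewrite -ler_expR lnK// posrE (lt_le_trans (expR_gt0 A)).
  apply/cvgryPge => A; near=> N.
  rewrite mul0r sub0r -mulNr -ler_pdivrMl ?oppr_gt0//.
  by near: N; exact: (cvgry_ge lln).
(* [ln y <= ln c + y / c] for every [c > 0]; with [|q| / c <= p / 2] the term
   [q ln y] is absorbed by half of [p y]. The summand [1] keeps [c] positive
   when [q = 0]. *)
pose c := 2 * `|q| / p + 1.
have c0 : 0 < c by rewrite ltr_pwDr// divr_ge0 ?mulr_ge0// ltW.
have qc : `|q| / c <= p / 2.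
  rewrite ler_pdivrMr// /c mulrDr mulr1 (_ : p / 2 * (2 * `|q| / p) = `|q|); last first.
    by field; rewrite gt_eqF.
  by rewrite lerDl divr_ge0// ltW.
apply/cvgryPge => A; near=> N.
have y1 : 1 <= ln N%:R :> R by near: N; exact: (cvgry_ge cvgr_lny).
have yA : (A + `|q| * `|ln c|) / (p / 2) <= ln N%:R :> R.
  by near: N; exact: (cvgry_ge cvgr_lny).
move: yA; rewrite ler_pdivrMr ?divr_gt0//.
set y := ln N%:R in y1 *; move=> yA.
have y0 : 0 < y by exact: lt_le_trans y1.
have lny : ln y <= `|ln c| + y / c.
  have : ln (y / c) < y / c by rewrite ln_sublinear// divr_gt0.
  rewrite ln_div ?posrE// ltrBlDr => /ltW; move/le_trans; apply.
  by rewrite addrC lerD2r ler_norm.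
have lny0 : 0 <= ln y by exact: ln_ge0.
have : q * ln y <= `|q| * (`|ln c| + y / c).
  apply: (@le_trans _ _ (`|q| * ln y)); first by rewrite ler_wpM2r// ler_norm.
  by rewrite ler_wpM2l.
have : `|q| * (y / c) <= p / 2 * y.
  by rewrite mulrA mulrAC ler_wpM2r// ltW.
rewrite mulrDr; lra.
Unshelve. all: end_near. Qed.

End Limits.

Section RescaledLaws.
Context {R : realType} {d : nat} (a : 'rV[R]_d).
Hypothesis a0 : forall j, 0 < a 0 j.
Local Notation F := (within (admissible a) \oo).

Lemma multi_indexE N j : admissible a N -> N%:R * a 0 j = (multi_index a N j)%:R.
Proof.
move=> [N0 aint]; rewrite truncnK// Num.Theory.natrEint aint /=.
by rewrite mulr_ge0// ltW.
Qed.

Lemma cvg_multi_index j : (fun N => multi_index a N j) @ F --> \oo.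
Proof.
apply: cvg_trans (cvg_app _ (cvg_within _)) _.
apply/cvgnyPge => A; near=> N.
have h : A%:R / a 0 j <= N%:R by near: N; exact: nbhs_infty_ger.
rewrite /multi_index Num.Theory.truncn_ge_nat; last by rewrite mulr_ge0// ltW.
by rewrite -ler_pdivrMr.
Unshelve. all: end_near. Qed.

Variable L : nat -> R.
Hypothesis hL : forall k, (0 < k)%N ->
  (\int[@lebesgue_measure R]_(u in `[0%R, +oo[) ((u * expR (1 - u)) ^+ k)%:E =
    (L k / Num.sqrt k%:R)%:E)%E.
Hypothesis L_cvg : L k @[k --> \oo] --> Num.sqrt (2 * pi).

Let L_gt0 j : \forall N \near F, 0 < L (multi_index a N j).
Proof.
have : \forall k \near \oo, 0 < L k.
  by apply: (cvgr_gt _ L_cvg); rewrite sqrtr_gt0 mulr_gt0// pi_gt0.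
exact: cvg_multi_index.
Qed.

Definition density_const N :=
  \prod_j (pi * Num.sqrt (a 0 j) * L (multi_index a N j)).

Local Notation Q := density_const.

Let Q_cvg : Q N @[N --> F] --> pi ^+ d * \prod_j Num.sqrt (2 * pi * a 0 j).
Proof.
have -> : pi ^+ d * \prod_j Num.sqrt (2 * pi * a 0 j) =
    \prod_j (pi * Num.sqrt (a 0 j) * Num.sqrt (2 * pi)).
  rewrite -[X in pi ^+ X]card_ord -prodr_const -big_split/=; apply: eq_bigr => j _.
  by rewrite [2 * pi * _]mulrC sqrtrM ?ltW// mulrA.
apply: cvg_big => [|j _]; first exact: mul_continuous.
apply: cvgM; first exact: cvg_cst.
exact: (cvg_comp _ _ (@cvg_multi_index j) L_cvg).
Qed.

Let Qlim_gt0 : 0 < pi ^+ d * \prod_j Num.sqrt (2 * pi * a 0 j).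
Proof.
rewrite mulr_gt0// ?exprn_gt0 ?pi_gt0//; apply: prodr_gt0 => j _.
by rewrite sqrtr_gt0 !mulr_gt0// pi_gt0.
Qed.

Lemma ln_density_const_cvg : ln (Q N) @[N --> F] --> gamma a.
Proof. by apply: continuous_cvg => //; exact: continuous_ln. Qed.

Let near_F (P : nat -> Prop) : (\forall N \near \oo, P N) -> \forall N \near F, P N.
Proof. exact: cvg_within. Qed.

Lemma cvg_admissible (f : nat -> R) (l : R) : f @ \oo --> l -> f @ F --> l.
Proof. by apply: cvg_trans; apply: cvg_app; exact: cvg_within. Qed.

(** With [delta] the entropy level of [sigmaNk_sublevel], the hypothesis says
    [delta / epsN --> 1]. The ratio in the law lies between
    [sqrt (rho * (1 - kappa)) ^ d] and [sqrt (rho * (1 + kappa)) ^ d] for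
    [rho = delta / epsN] and [kappa] the error of the quadratic sandwich, which
    tends to [0] because [delta] does. *)
Lemma rescaled_law_of (tN epsN : nat -> R) :
  (\forall N \near \oo, 0 < tN N) -> (\forall N \near \oo, 0 < epsN N) ->
  epsN @ \oo --> (0 : R) ->
  (- ln (tN N) + d%:R / 2 * ln N%:R - ln (Q N)) / (N%:R * epsN N)
    @[N --> F] --> (1 : R) ->
  rescaled_law a tN epsN.
Proof.
move=> t0 e0 eps_cvg rho_cvg.
pose delta N := (- ln (tN N) + d%:R / 2 * ln N%:R - ln (Q N)) / N%:R.
pose rho N := (- ln (tN N) + d%:R / 2 * ln N%:R - ln (Q N)) / (N%:R * epsN N).
(* The default value [1] of the minimum keeps [m] positive when [d = 0]. *)
have [m m0 ma] : exists2 m : R, 0 < m & forall j, m <= a 0 j.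
  exists (\big[Num.min/1]_j a 0 j); first by elim/big_ind : _ => // x y x0 y0; rewrite lt_min x0.
  by move=> j; rewrite (bigD1 j)//= ge_min lexx.
have eps_F := cvg_admissible eps_cvg.
have deltaE : \forall N \near F, delta N = rho N * epsN N.
  near=> N; rewrite /delta /rho.
  have N0 : (N%:R : R) != 0.
    rewrite gt_eqF//; near: N; apply: near_F; exact: nbhs_infty_gtr.
  have eN : epsN N != 0 by rewrite gt_eqF//; near: N; exact: near_F.
  by field; rewrite N0 eN.
have delta_cvg : delta @ F --> (0 : R).
  rewrite -(mul1r (0 : R)); apply: cvg_trans (cvgM rho_cvg eps_F).
  by apply: near_eq_cvg; near do apply/esym.
have rho0 : \forall N \near F, 0 < rho N by exact: (cvgr_gt _ rho_cvg).
have k_cvg : sandwich_err m (delta N) @[N --> F] --> (0 : R).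
  rewrite -(mulr0 2); apply: cvgM; first exact: cvg_cst.
  rewrite -[X in _ --> X](@sqrtr0 R); apply: continuous_cvg; first exact: sqrt_continuous.
  by rewrite -(mul0r m^-1); apply: cvgM => //; exact: cvg_cst.
have bound_cvg (s : nat -> R) : s @ F --> (1 : R) ->
    Num.sqrt (rho N * s N) ^+ d @[N --> F] --> (1 : R).
  move=> s1; rewrite -[X in _ --> X](expr1n _ d) -[X in X ^+ d]sqrtr1.
  have sqrt1 : Num.sqrt (rho N * s N) @[N --> F] --> Num.sqrt (1 : R).
    apply: continuous_cvg; first exact: sqrt_continuous.
    by rewrite -[X in _ --> X](mulr1 1); exact: cvgM.
  exact: (cvg_comp _ _ sqrt1 (@exprn_continuous R d (Num.sqrt 1))).
apply: (squeeze_cvgr _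
  (bound_cvg (fun N => 1 - sandwich_err m (delta N)) _)
  (bound_cvg (fun N => 1 + sandwich_err m (delta N)) _)); last 2 first.
- by rewrite -[X in _ --> X](subr0 1); apply: cvgB => //; exact: cvg_cst.
- by rewrite -[X in _ --> X](addr0 1); apply: cvgD => //; exact: cvg_cst.
near=> N.
have adm : admissible a N by near: N; exact: withinT.
have NR0 : 0 < N%:R :> R by rewrite ltr0n; case: adm.
have tN0 : 0 < tN N by near: N; exact: near_F.
have eN0 : 0 < epsN N by near: N; exact: near_F.
have dE : delta N = rho N * epsN N by near: N.
have rN0 : 0 < rho N by near: N.
have d0 : 0 < delta N by rewrite dE mulr_gt0.
have dm : 4 * delta N < m.
  rewrite mulrC -ltr_pdivlMr//; near: N; apply: (cvgr_lt _ delta_cvg).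
  by rewrite divr_gt0.
have LN0 : forall j, 0 < L (multi_index a N j).
  near: N; apply: filter_forall => j; exact: L_gt0.
have Q0 : 0 < Q N.
  by apply: prodr_gt0 => j _; rewrite !mulr_gt0 ?pi_gt0 ?sqrtr_gt0.
have sigmaE : sigmaNk N (multi_index a N) `[tN N, +oo[ =
    lebesgueC (entropy_sublevel (fun j => a 0 j) (delta N)).
  rewrite (@sigmaNk_sublevel R L hL d (fun j => a 0 j) N (multi_index a N))//; last 2 first.
  - by case: adm.
  - by move=> j; exact: multi_indexE.
  congr (lebesgueC (entropy_sublevel _ _)); rewrite /delta; congr (_ / _).
  have -> : \prod_j (pi * Num.sqrt (a 0 j) / Num.sqrt N%:R * L (multi_index a N j)) =
      Q N * (Num.sqrt N%:R) ^- d.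
    rewrite -[X in _ ^- X]card_ord -exprVn -prodr_const -big_split/=.
    by apply: eq_bigr => j _; rewrite mulrAC.
  rewrite lnM ?posrE ?mulr_gt0 ?invr_gt0 ?exprn_gt0 ?sqrtr_gt0//.
  rewrite lnM ?posrE ?invr_gt0 ?exprn_gt0 ?sqrtr_gt0//.
  rewrite lnV ?posrE ?exprn_gt0 ?sqrtr_gt0// lnXn ?sqrtr_gt0//.
  by rewrite -powR12_sqrt ?ltW// ln_powR; field.
have := volume_entropy_sublevel a0 m0 ma d0 dm; rewrite -sigmaE.
have k0 := sandwich_err_gt0 m0 d0.
have k1 := sandwich_err_lt1 m0 d0 dm.
set D := (2 * pi) ^+ d * _ * _.
have volE e : 0 < e -> (\prod_j (pi * Num.sqrt (2 * a 0 j * (e * delta N)))) *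
    unit_ball_volume d = Num.sqrt (rho N * e) ^+ d * D.
  move=> e_gt0; have re0 : 0 <= rho N * e by apply: mulr_ge0; exact: ltW.
  have -> : \prod_j (pi * Num.sqrt (2 * a 0 j * (e * delta N))) =
      \prod_j (Num.sqrt (rho N * e) * (2 * pi) * Num.sqrt (a 0 j * epsN N / 2)).
    apply: eq_bigr => j _; rewrite dE.
    have -> : 2 * a 0 j * (e * (rho N * epsN N)) =
        2 ^+ 2 * (rho N * e * (a 0 j * epsN N / 2)) by field.
    rewrite sqrtrM ?sqr_ge0// sqrtr_sqr ger0_norm// (sqrtrM _ re0).
    by rewrite mulrCA mulrA mulrA; congr (_ * _); rewrite mulrC.
  rewrite !big_split/= !prodr_const card_ord /D exprMn.
  by rewrite -!mulrA; congr (_ * (_ * (_ * _))); rewrite mulrC.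
have D0 : 0 < D.
  rewrite /D !mulr_gt0 ?exprn_gt0 ?mulr_gt0 ?pi_gt0 ?unit_ball_volume_gt0//.
  by apply: prodr_gt0 => j _; rewrite sqrtr_gt0 divr_gt0// mulr_gt0.
rewrite !volE; [|lra..].
by rewrite ler_pdivlMr// ler_pdivrMr.
Unshelve. all: end_near. Qed.

End RescaledLaws.

(** The analytic content of all three laws: [- ln tN + d / 2 * ln N - gamma] must be
    asymptotic to [N * epsN], up to an error [o(1)] in [gamma]. *)
Lemma rescaled_law_criterion (R : realType) (d : nat) (a : 'rV[R]_d) :
  (forall j, 0 < a 0 j) ->
  exists2 g : nat -> R, g @ within (admissible a) \oo --> gamma a &
  forall tN epsN : nat -> R,
    (\forall N \near \oo, 0 < tN N) -> (\forall N \near \oo, 0 < epsN N) ->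
    epsN @ \oo --> (0 : R) ->
    (- ln (tN N) + d%:R / 2 * ln N%:R - g N) / (N%:R * epsN N)
      @[N --> within (admissible a) \oo] --> (1 : R) ->
    rescaled_law a tN epsN.
Proof.
move=> a0; have [L [L_cvg hL]] := @laplace_gamma R.
exists (fun N => ln (density_const a L N)); first exact: ln_density_const_cvg.
by move=> tN epsN t0 e0 e_cvg; exact: rescaled_law_of.
Qed.

Theorem mainTheorem4 (R : realType) (d : nat) (G : subtorus R d)
    (g : {vspace 'rV[R]_d}) (hg : is_lie_algebra G g)
    (lambda : 'Hom(subvs_of g, R^o)) (hlambda : is_weight lambda)
    (hred : compact_toric_reduction G lambda)
    (a : 'rV[R]_d) (ha : Delta lambda a) (ha0 : forall j, 0 < a 0 j) :
  (forall t : R, 0 < t -> ln t < - gamma a ->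
     rescaled_law a
       (fun N => N%:R `^ (d%:R / 2) * t)
       (fun N => (- ln t - gamma a) / N%:R)) /\
  (forall t alpha beta : R, 0 < t ->
     (0 < alpha /\ alpha < 1) \/ (alpha = 0 /\ 1 < beta) ->
     rescaled_law a
       (fun N => expR (- (N%:R `^ alpha * ln N%:R `^ beta * t)))
       (fun N => N%:R `^ (alpha - 1) * ln N%:R `^ beta * t)) /\
  (forall t : R, 0 < d%:R + 2 * t ->
     rescaled_law a
       (fun N => N%:R `^ (- t))
       (fun N => (d%:R + 2 * t) / (2 * N%:R) * ln N%:R)).
Proof.
have [h h_cvg law] := rescaled_law_criterion ha0.
have N_gt0 : \forall N \near \oo, 0 < N%:R :> R by exact: nbhs_infty_gtr.
have ln_gt0N : \forall N \near \oo, 0 < ln N%:R :> R by exact: (cvgry_gt (@cvgr_lny R)).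
have Nv_cvg : N%:R^-1 @[N --> \oo] --> (0 : R).
  by apply/gtr0_cvgV0 => //; exact: cvgr_idn.
have lnv_cvg : (ln N%:R)^-1 @[N --> \oo] --> (0 : R).
  by apply/gtr0_cvgV0 => //; exact: cvgr_lny.
split; [|split].
(* The factor [N `^ (d / 2)] of [t_N] cancels the term [d / 2 * ln N] exactly. *)
- move=> t t0 tg; set c := - ln t - gamma a.
  have c0 : 0 < c by rewrite /c; lra.
  apply: law.
  + by near=> N; rewrite mulr_gt0// powR_gt0//; near: N.
  + by near=> N; rewrite divr_gt0//; near: N.
  + by rewrite -(mulr0 c); apply: cvgM => //; exact: cvg_cst.
  + have num_cvg : (- ln t - h N) / c @[N --> within (admissible a) \oo] --> (1 : R).
      rewrite -(@divff _ c) ?gt_eqF//; apply: cvgM; last exact: cvg_cst.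
      by apply: cvgB => //; exact: cvg_cst.
    apply: cvg_trans num_cvg; apply: near_eq_cvg; near=> N.
    have N0 : 0 < N%:R :> R by near: N; exact: cvg_within.
    rewrite [N%:R * _]mulrC divfK ?gt_eqF// lnM ?posrE ?powR_gt0// ln_powR.
    by congr (_ / _); ring.
(* [- ln t_N] is [D N = N eps_N] itself, and [ln N] and [1], that is the powers
   [q = 1] and [q = 0] of [ln N], are negligible against it: this is where the
   two alternatives for [alpha] and [beta] are needed. *)
- move=> t alpha beta t0 ab; pose D N : R := N%:R `^ alpha * ln N%:R `^ beta * t.
  have t_neq0 : t != 0 by rewrite gt_eqF.
  have epsE : \forall N \near \oo, N%:R * (N%:R `^ (alpha - 1) * ln N%:R `^ beta * t) = D N.
    near=> N; have N0 : 0 < N%:R :> R by near: N.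
    by rewrite /D !mulrA -{1}[N%:R]powRr1 ?ltW// -powRD ?(gt_eqF N0) ?implybT// addrCA subrr addr0.
  have D_gt0 : \forall N \near \oo, 0 < D N.
    by near=> N; rewrite !mulr_gt0// powR_gt0//; near: N.
  have Dv_cvg (q : R) : 0 < alpha \/ alpha = 0 /\ q - beta < 0 ->
      ln N%:R `^ q / D N @[N --> \oo] --> (0 : R).
    move=> hq; rewrite -(mul0r t^-1).
    apply: cvg_trans (cvgM (cvg_powR_ln hq) (cvg_cst t^-1)).
    apply: near_eq_cvg; near=> N.
    have N0 : 0 < N%:R :> R by near: N.
    have l0 : 0 < ln N%:R :> R by near: N.
    rewrite /D /= powRN powRB ?(gt_eqF l0) ?implybT//.
    by field; rewrite t_neq0 !gt_eqF ?powR_gt0.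
  have [alpha_lt1 [hb1 hb0]] : alpha < 1 /\ ((0 < alpha \/ alpha = 0 /\ 1 - beta < 0) /\
      (0 < alpha \/ alpha = 0 /\ 0 - beta < 0)).
    by case: ab => [[? ?]|[? ?]]; split; [|split; left| lra|split; right; split=> //; lra].
  apply: law.
  + by near=> N; exact: expR_gt0.
  + by near=> N; rewrite !mulr_gt0// powR_gt0//; near: N.
  + rewrite -(mul0r t); apply: cvgM; last exact: cvg_cst.
    by rewrite -opprB; apply: cvg_powR_ln; left; rewrite subr_gt0.
  + have num_cvg : 1 + d%:R / 2 * (ln N%:R `^ 1 / D N) - h N * (ln N%:R `^ 0 / D N)
        @[N --> within (admissible a) \oo] --> (1 : R).
      rewrite -[X in _ --> X](subr0 1) -[X in _ --> X - _](addr0 1).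
      apply: cvgB; first apply: cvgD; first exact: cvg_cst.
        rewrite -(mulr0 (d%:R / 2)); apply: cvgM; first exact: cvg_cst.
        apply: cvg_admissible; exact: (Dv_cvg 1 hb1).
      rewrite -[X in _ --> X](mulr0 (gamma a)); apply: cvgM; first exact: h_cvg.
      apply: cvg_admissible; exact: (Dv_cvg 0 hb0).
    apply: cvg_trans num_cvg; apply: near_eq_cvg; near=> N.
    have l0 : 0 < ln N%:R :> R by near: N; exact: cvg_within.
    have D0 : D N != 0 by rewrite gt_eqF//; near: N; exact: cvg_within.
    have -> : N%:R * (N%:R `^ (alpha - 1) * ln N%:R `^ beta * t) = D N.
      by near: N; exact: cvg_within.
    rewrite -/(D N) expRK opprK powRr0 powRr1 ?ltW//.
    by field.
(* Both [- ln t_N] and [d / 2 * ln N] contribute to the leading term [c / 2 * ln N]. *)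
- move=> t dt; set c := d%:R + 2 * t.
  have c2 : 0 < c / 2 by rewrite divr_gt0.
  have epsE : \forall N \near \oo, c / (2 * N%:R) * ln N%:R = c / 2 * (N%:R `^ (-1) * ln N%:R `^ 1).
    near=> N; have N0 : 0 < N%:R :> R by near: N.
    have l0 : 0 < ln N%:R :> R by near: N.
    by rewrite powR_inv1 ?powRr1 ?ltW// invfM !mulrA.
  apply: law.
  + by near=> N; rewrite powR_gt0//; near: N.
  + near=> N; have N0 : 0 < N%:R :> R by near: N.
    by rewrite mulr_gt0 ?divr_gt0 ?mulr_gt0//; near: N.
  + have : c / 2 * (N%:R `^ (-1) * ln N%:R `^ 1) @[N --> \oo] --> (0 : R).
      rewrite -(mulr0 (c / 2)); apply: cvgM; first exact: cvg_cst.
      by apply: cvg_powR_ln; left; exact: ltr01.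
    by apply: cvg_trans; apply: near_eq_cvg; near=> N; apply/esym; near: N.
  + have num_cvg : 1 - h N * (ln N%:R)^-1 * (c / 2)^-1 @[N --> within (admissible a) \oo] --> (1 : R).
      rewrite -[X in _ --> X](subr0 1); apply: cvgB; first exact: cvg_cst.
      rewrite -[X in _ --> X](mul0r (c / 2)^-1); apply: cvgM; last exact: cvg_cst.
      rewrite -[X in _ --> X](mulr0 (gamma a)); apply: cvgM; first exact: h_cvg.
      by apply: cvg_admissible; exact: lnv_cvg.
    apply: cvg_trans num_cvg; apply: near_eq_cvg; near=> N.
    have N0 : 0 < N%:R :> R by near: N; exact: cvg_within.
    have l0 : 0 < ln N%:R :> R by near: N; exact: cvg_within.
    rewrite ln_powR (_ : - (- t * _) + _ = c / 2 * ln N%:R); last by rewrite /c; field.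
    by field; rewrite !gt_eqF.
Unshelve. all: end_near. Qed.
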